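(* Let $N\ge 1$, let $\Omega\subseteq\mathbb{R}^N$ be a nonempty open set of finite measure and let $2<p\le 2+\frac4N$. If for some $\bar\lambda\in\mathbb{R}$ there exist two action ground states $v_1,v_2\in\mathcal{N}_{\bar\lambda}$ with different masses (i.e. $\|v_1\|_2\ne\|v_2\|_2$), then $$\mathcal{J}(\bar\lambda)>\mathcal{J}^{**}(\bar\lambda)=\sup_{\mu\ge0}\bigl(\bar\lambda\mu+\mathcal{E}(\mu)\bigr).$$ In particular, $\mathcal{J}$ is not a convex function on $\mathbb{R}$.
   Context: $\|\cdot\|_q$ is the norm of $L^q(\Omega)$; functions are real-valued. For $\lambda\in\mathbb{R}$ and $u\in H_0^1(\Omega)$, the action functional is $J_\lambda(u)=\frac12\|\nabla u\|_2^2+\frac\lambda2\|u\|_2^2-\frac1p\|u\|_p^p$ and the energy functional is $E(u)=\frac12\|\nabla u\|_2^2-\frac1p\|u\|_p^p$. The Nehari manifold is $\mathcal{N}_\lambda=\{u\in H_0^1(\Omega)\setminus\{0\}:\ \|\nabla u\|_2^2+\lambda\|u\|_2^2=\|u\|_p^p\}$. The mass-constrained space is $\mathcal{M}_\mu=\{u\in H_0^1(\Omega):\ \frac12\|u\|_2^2=\mu\}$ for $\mu\ge0$; the mass of $u$ is $\frac12\|u\|_2^2$. The levels are $\mathcal{J}(\lambda)=\inf_{v\in\mathcal{N}_\lambda}J_\lambda(v)$ and $\mathcal{E}(\mu)=\inf_{v\in\mathcal{M}_\mu}E(v)\in[-\infty,+\infty)$. A function $u\in\mathcal{N}_\lambda$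 is an action ground state if $J_\lambda(u)=\mathcal{J}(\lambda)$. The Legendre--Fenchel transform is $\mathcal{J}^*(\mu)=\sup_{\lambda\in\mathbb{R}}(\lambda\mu-\mathcal{J}(\lambda))$ for $\mu\in\mathbb{R}$, and $\mathcal{J}^{**}(\lambda)=\sup_{\mu\in\mathbb{R}}(\lambda\mu-\mathcal{J}^*(\mu))$. *)

(* Defs.v *)
From HB Require Import structures.
From mathcomp Require Import all_boot all_order all_algebra.
From mathcomp Require Import all_classical all_reals all_analysis.
From mathcomp Require Import measurable_realfun.
Set Implicit Arguments.
Unset Strict Implicit.
Unset Printing Implicit Defensive.
Import Order.TTheory GRing.Theory Num.Theory.
Import numFieldNormedType.Exports.
Local Open Scope classical_set_scope.
Local Open Scope ring_scope.

(* ['rV[R]_n] carries the sigma-algebra generated by the coordinates, that is,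
   the Borel sigma-algebra. *)
Section measurable_rV.
Context {R : realType} (n : nat).

Let coor (i : 'I_n) (v : 'rV[R]_n) : R := v ord0 i.

Let rV_set0 : g_sigma_preimage coor set0.
Proof. exact: sigma_algebra0. Qed.

Let rV_setC A : g_sigma_preimage coor A -> g_sigma_preimage coor (~` A).
Proof. exact: sigma_algebraC. Qed.

Let rV_bigcup (F : (set 'rV[R]_n)^nat) :
  (forall i, g_sigma_preimage coor (F i)) ->
  g_sigma_preimage coor (\bigcup_i (F i)).
Proof. exact: sigma_algebra_bigcup. Qed.

HB.instance Definition _ := Pointed.on 'rV[R]_n.
HB.instance Definition _ := @isMeasurable.Build default_measure_display
  'rV[R]_n (g_sigma_preimage coor) rV_set0 rV_setC rV_bigcup.

Lemma measurable_coor_rV (i : 'I_n) :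
  measurable_fun [set: 'rV[R]_n] (fun v : 'rV[R]_n => v ord0 i).
Proof.
move=> _ Y mY; rewrite setTI; apply: sub_sigma_algebra => /=.
rewrite -bigcup_seq/=; exists i => /=; first by rewrite mem_index_enum.
by exists Y => //; rewrite setTI.
Qed.

Lemma measurable_fun_rV d (T : measurableType d) (f : T -> 'rV[R]_n) :
  (forall i, measurable_fun [set: T] (fun x => f x ord0 i)) ->
  measurable_fun [set: T] f.
Proof.
move=> mf _ A mA; rewrite setTI.
pose F := image_set_system setT f (@measurable d T).
suff : F A by rewrite /F/image_set_system /= setTI.
apply: mA; split.
  by apply: sigma_algebra_image; exact: sigma_algebra_measurable.
rewrite -bigcup_seq => B [/= i _ [C mC <-]].
rewrite /F /image_set_system /= !setTI -comp_preimage -[X in measurable X]setTI.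
exact: mf.
Qed.

End measurable_rV.

Section lebesgue_rV.
Context {R : realType}.

Definition row_cons n (x : R * 'rV[R]_n) : 'rV[R]_n.+1 :=
  \row_i oapp (x.2 ord0) x.1 (unlift ord0 i).

Lemma row_cons0 n (x : R * 'rV[R]_n) : row_cons x ord0 ord0 = x.1.
Proof. by rewrite mxE unlift_none. Qed.

Lemma row_consS n (x : R * 'rV[R]_n) (i : 'I_n) :
  row_cons x ord0 (lift ord0 i) = x.2 ord0 i.
Proof. by rewrite mxE liftK. Qed.

Lemma measurable_row_cons n :
  measurable_fun [set: measurableTypeR R * 'rV[R]_n]
    (fun x => row_cons x : 'rV[R]_n.+1).
Proof.
apply: measurable_fun_rV => i; case: (unliftP ord0 i) => [j|] ->.
  under eq_fun do rewrite row_consS.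
  apply: (@measurableT_comp _ _ _ _ _ _ (fun v : 'rV[R]_n => v ord0 j)) => //.
  exact: measurable_coor_rV.
by under eq_fun do rewrite row_cons0; exact: measurable_fst.
Qed.

Lemma sigma_finite_product_measure1 d1 d2 (T1 : measurableType d1)
  (T2 : measurableType d2) (m1 : {sigma_finite_measure set T1 -> \bar R})
  (m2 : {sigma_finite_measure set T2 -> \bar R}) :
  sigma_finite setT (m1 \x m2)%E.
Proof.
have /sigma_finiteP[F [TF ndF Foo]] := sigma_finiteT m1.
have /sigma_finiteP[G [TG ndG Goo]] := sigma_finiteT m2.
exists (fun n => F n `*` G n).
  rewrite -setXTT TF TG predeqE => -[x y]; split.
    move=> [/= [i _ Fix] [k _ Gky]]; exists (maxn i k) => //; split.
    - by move: x Fix; exact/subsetPset/ndF/leq_maxl.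
    - by move: y Gky; exact/subsetPset/ndG/leq_maxr.
  by move=> [i _ []/= ? ?]; split; exists i.
move=> k; have [? ?] := Foo k; have [? ?] := Goo k.
split; first exact: measurableX.
by rewrite product_measure1E// lte_mul_pinfty// ge0_fin_numE.
Qed.

Section step.
Context n (m : {sigma_finite_measure set 'rV[R]_n -> \bar R}).

Definition lebesgue_succ : set 'rV[R]_n.+1 -> \bar R :=
  pushforward (@lebesgue_measure R \x m)%E (@row_cons n).

Let lebesgue_succ0 : lebesgue_succ set0 = 0%E.
Proof. by rewrite /lebesgue_succ /pushforward preimage_set0 measure0. Qed.

Let lebesgue_succ_ge0 A : (0 <= lebesgue_succ A)%E.
Proof. by rewrite /lebesgue_succ /pushforward; exact: measure_ge0. Qed.

Let lebesgue_succ_sigma_additive : semi_sigma_additive lebesgue_succ.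
Proof.
have mc := @measurable_row_cons n.
move=> F mF tF mUF; rewrite /lebesgue_succ /pushforward preimage_bigcup.
apply: measure_semi_sigma_additive.
- by move=> k; rewrite -[X in measurable X]setTI; exact: mc.
- apply/trivIsetP => /= i j _ _ ij; rewrite -preimage_setI.
  by move/trivIsetP : tF => /(_ _ _ _ _ ij) ->//; rewrite preimage_set0.
- by rewrite -preimage_bigcup -[X in measurable X]setTI; exact: mc.
Qed.

HB.instance Definition _ := isMeasure.Build _ _ _ lebesgue_succ
  lebesgue_succ0 lebesgue_succ_ge0 lebesgue_succ_sigma_additive.

Let lebesgue_succ_sigma_finite : sigma_finite setT lebesgue_succ.
Proof.
have [H HT Hoo] : sigma_finite setT (@lebesgue_measure R \x m)%E.
  exact: sigma_finite_product_measure1.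
pose uncons (v : 'rV[R]_n.+1) : measurableTypeR R * 'rV[R]_n :=
  (v ord0 ord0, \row_i v ord0 (lift ord0 i)).
have consK : cancel (@row_cons n) uncons.
  move=> [x v]; rewrite /uncons row_cons0; congr pair.
  by apply/rowP => i; rewrite mxE row_consS.
have unconsm : measurable_fun [set: 'rV[R]_n.+1] uncons.
  apply: measurable_fun_pair; first exact: measurable_coor_rV.
  apply: measurable_fun_rV => i; under eq_fun do rewrite mxE.
  exact: measurable_coor_rV.
exists (fun k => uncons @^-1` H k).
  by rewrite -preimage_bigcup -HT preimage_setT.
move=> k; have [mH Hk] := Hoo k; split.
  by rewrite -[X in measurable X]setTI; exact: unconsm.
rewrite /lebesgue_succ /pushforward -comp_preimage.
by rewrite (_ : uncons \o _ = idfun)//; apply/funext => x /=; rewrite consK.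
Qed.

HB.instance Definition _ := Measure_isSigmaFinite.Build _ _ _ lebesgue_succ
  lebesgue_succ_sigma_finite.

End step.

(* Iterated product of the one-dimensional Lebesgue measure; on ['rV[R]_0],
   the unit mass at the only point. *)
Fixpoint lebesgue_rV n : {sigma_finite_measure set 'rV[R]_n -> \bar R} :=
  if n is n'.+1 then lebesgue_succ (lebesgue_rV n') else \d_(0 : 'rV[R]_0).
End lebesgue_rV.

Lemma lebesgue_rV_box (R : realType) n (A : 'I_n -> set R) :
  (forall i, measurable (A i)) ->
  lebesgue_rV n [set v : 'rV[R]_n | forall i, A i (v ord0 i)] =
  (\prod_(i < n) (lebesgue_measure (A i)))%E.
Proof.
elim: n A => [|n IHn] A mA.
  rewrite big_ord0 /= diracE mem_set//= => -[].
  by case.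
rewrite big_ord_recl -IHn// -product_measure1E//; last 2 first.
- exact: mA.
- rewrite (_ : [set v | _] = \bigcap_(i in [set: 'I_n])
    ((fun v : 'rV[R]_n => v ord0 i) @^-1` A (lift ord0 i))); last first.
    by apply/seteqP; split => v /= Av i; [move=> _; exact: Av|exact: Av].
  apply: fin_bigcap_measurable => // i _; rewrite -[X in measurable X]setTI.
  exact: measurable_coor_rV.
rewrite /= /lebesgue_succ /pushforward; congr (product_measure1 _ _ _).
apply/seteqP; split => -[x v] /=.
  move=> Axv; split; first by have := Axv ord0; rewrite row_cons0.
  by move=> i; have := Axv (lift ord0 i); rewrite row_consS.
move=> [Ax Av] i; case: (unliftP ord0 i) => [j|] ->.
  by rewrite row_consS; exact: Av.
by rewrite row_cons0.
Qed.

(* Every open set is measurable: it is a countable union of rational boxes. *)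
Lemma open_measurable_rV (R : realType) n (U : set 'rV[R]_n) :
  open U -> measurable U.
Proof.
move=> oU.
pose B (qr : 'rV[rat]_n * rat) : set 'rV[R]_n :=
  [set v | forall i, `|ratr (qr.1 ord0 i) - v ord0 i| < ratr qr.2].
have mB qr : measurable (B qr).
  rewrite (_ : B qr = \bigcap_(i in [set: 'I_n])
    ((fun v : 'rV[R]_n => v ord0 i) @^-1`
      ball (ratr (qr.1 ord0 i) : R) (ratr qr.2))); last first.
    by apply/seteqP; split => v /= Bv i; [move=> _; exact: Bv|exact: Bv].
  apply: fin_bigcap_measurable => // i _; rewrite -[X in measurable X]setTI.
  by apply: measurable_coor_rV => //; exact: measurable_ball.
rewrite (_ : U = \bigcup_(qr in [set qr | B qr `<=` U]) B qr); last first.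
  apply/seteqP; split => [v Uv|v [qr /= BU Bv]]; last exact: BU.
  have /nbhs_ballP[e /= e0 eU] := open_nbhs_nbhs (conj oU Uv).
  have [r /andP[r0 re]] : exists r : rat, 0 < (ratr r : R) < e / 2.
    have [r rI] := rat_in_itvoo (divr_gt0 e0 (ltr0Sn R 1)).
    by exists r; move: rI; rewrite in_itv.
  have /fin_all_exists[q qP] (i : 'I_n) :
      exists q : rat, `|ratr q - v ord0 i| < ratr r.
    have : v ord0 i - ratr r < v ord0 i + ratr r by rewrite ltrBlDr -addrA ltrDl addr_gt0.
    by move=> /rat_in_itvoo[q]; rewrite in_itv /= => qP; exists q; rewrite ltr_distl.
  exists (\row_i q i, r) => /=; last by move=> i; rewrite mxE.
  move=> w /= Bw; apply: eU; split => // i j; rewrite ord1 /=.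
  have := Bw j; rewrite /= mxE => Bwj.
  rewrite /ball /= (splitr e).
  rewrite (le_lt_trans (ler_distD (ratr (q j)) _ _))// ltrD//.
    by rewrite distrC (lt_trans (qP j)).
  by rewrite (lt_trans Bwj).
rewrite bigcup_mkcond; apply: countable_bigcupT_measurable => [|qr].
  exact: countableP.
by case: ifP.
Qed.

Section sobolev.
Context {R : realType} {N : nat}.
Local Notation E := 'rV[R]_N.
Implicit Types (Om : set E) (u f : E -> R) (G : E -> E).

Definition enorm (v : E) : R := Num.sqrt (\sum_i v ord0 i ^+ 2).

(* [L^q(Om)]-norm; functions are defined on the whole space, and only their
   restriction to [Om] matters. *)
Definition Lq Om (q : R) u : \bar R :=
  Lnorm (lebesgue_rV N) q%:E (EFin \o (u \_ Om)).

Definition inL2 Om u : Prop := (u \_ Om) \in Lfun (lebesgue_rV N) 2%:E.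

Definition partial (i : 'I_N) f : E -> R := fun x => 'D_(delta_mx ord0 i) f x.

Definition gradient f : E -> E := fun x => \row_i partial i f x.

(* [f] is C^oo on the whole space: all its iterated partial derivatives are
   differentiable. *)
Definition smooth f : Prop :=
  forall (s : seq 'I_N) (x : E), differentiable (foldr partial f s) x.

(* [C_c^oo(Om)], each function being extended by zero outside [Om]. *)
Definition test_function Om f : Prop :=
  [/\ smooth f, compact (closure [set x | f x != 0])
    & closure [set x | f x != 0] `<=` Om].

Definition weak_gradient Om u G : Prop :=
  forall f, test_function Om f -> forall i : 'I_N,
    \int[lebesgue_rV N]_(x in Om) (u x * partial i f x) =
    - \int[lebesgue_rV N]_(x in Om) (G x ord0 i * f x).

(* An element of [H^1_0(Om)], the closure of [C_c^oo(Om)] in [H^1(Om)]. It is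
   given by a representative [u] together with a representative of its weak
   gradient, so that functionals of the gradient need no choice. *)
Record H01 Om := MkH01 {
  h01_fun :> E -> R;
  h01_grad : E -> E;
  h01_funL2 : inL2 Om h01_fun;
  h01_gradL2 : forall i, inL2 Om (fun x => h01_grad x ord0 i);
  h01_weak : weak_gradient Om h01_fun h01_grad;
  h01_closure : forall e : R, 0 < e -> exists2 f, test_function Om f &
    (Lq Om 2 (h01_fun \- f)%R < e%:E)%E /\
    (Lq Om 2 (fun x => enorm (h01_grad x - gradient f x)%R) < e%:E)%E }.

End sobolev.

Section functionals.
Context {R : realType} {N : nat} {Om : set 'rV[R]_N}.
Local Open Scope ereal_scope.
Implicit Types (u : H01 Om) (p lam mu : R).

(* [||u||_q^q] and [||grad u||_2^2]. The former is an extended real: that it is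
   finite on [H^1_0(Om)] for subcritical [q] is the Sobolev embedding. The sums
   below are well defined in any case, [||u||_2] and [||grad u||_2] being
   finite. *)
Definition Lqpow (q : R) u : \bar R := Lq Om q u `^ q.
Definition dirichlet u : \bar R := Lq Om 2 (enorm \o h01_grad u) `^ 2.

Definition action p lam u : \bar R :=
  (2^-1)%:E * dirichlet u + (lam / 2)%:E * Lqpow 2 u - (p^-1)%:E * Lqpow p u.

Definition energy p u : \bar R :=
  (2^-1)%:E * dirichlet u - (p^-1)%:E * Lqpow p u.

Definition nonzero u : Prop :=
  ~ {ae lebesgue_rV N, forall x, Om x -> u x = 0%R}.

Definition mass u : \bar R := (2^-1)%:E * Lqpow 2 u.

End functionals.

Section levels.
Context {R : realType} {N : nat} (Om : set 'rV[R]_N).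
Local Open Scope ereal_scope.
Implicit Types (p lam mu : R).

Definition nehari p lam : set (H01 Om) :=
  [set u | nonzero u /\ dirichlet u + lam%:E * Lqpow 2 u = Lqpow p u].

Definition mass_constrained mu : set (H01 Om) := [set u | mass u = mu%:E].

Definition action_level p lam : \bar R :=
  ereal_inf [set action p lam v | v in nehari p lam].

Definition energy_level p mu : \bar R :=
  ereal_inf [set energy p v | v in mass_constrained mu].

Definition action_ground_state p lam (u : H01 Om) : Prop :=
  nehari p lam u /\ action p lam u = action_level p lam.

End levels.

Section convex_analysis.
Context {R : realType}.
Local Open Scope ereal_scope.

Definition legendre (F : R -> \bar R) (y : R) : \bar R :=
  ereal_sup [set (x * y)%:E - F x | x in [set: R]].

Definition convex_ereal (F : R -> \bar R) : Prop :=
  forall (x y t : R), (0 <= t <= 1)%R ->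
    F (t * x + (1 - t) * y)%R <= t%:E * F x + (1 - t)%:E * F y.

End convex_analysis.

(* Main.v *)
Require Import Defs.
From HB Require Import structures.
From mathcomp Require Import all_boot all_order all_algebra.
From mathcomp Require Import all_classical all_reals all_analysis.
From mathcomp Require Import measurable_realfun.
From mathcomp Require Import ring lra.
Set Implicit Arguments.
Unset Strict Implicit.
Unset Printing Implicit Defensive.
Import Order.TTheory GRing.Theory Num.Theory.
Import numFieldNormedType.Exports.

(** Every step compares functions on one ray [t *: u], where the action is
    explicit: for [v] on the Nehari manifold at [lam], the action of [t *: v] is
    [P * fiber p (t ^+ 2)], with [P] the [p]-th power of the [L^p]-norm of [v]
    and [fiber p] increasing up to [1] and decreasing afterwards.

    Duality. For each mass [mu >= 0] the ray through [v] contains an element of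
    mass [mu], whose action is at most that of [v]; since the action is the
    energy plus [lam] times the mass, [lam * mu + energy_level mu] is at most
    the action level at [lam] ([dual_le_action_level]). Conversely, any [u] of
    mass [mu > 0] satisfies the Nehari equation for the multiplier
    [lam = (|u|_p ^ p - |grad u|_2 ^ 2) / |u|_2 ^ 2], so the action level at
    that multiplier is at most [energy u + lam * mu] ([conjugate_energy_le]),
    whether or not [u] is a minimizer. Hence the conjugate of the action level
    is minus the energy level at positive masses, and the biconjugate at [lam]
    is the supremum of [lam * mu + energy_level mu]
    ([biconjugate_action_level]).

    The converse direction requires [|u|_p] to be finite. Instead of a Sobolev
    inequality, an element with infinite [L^p]-norm is replaced by test
    functions of the same mass and arbitrarily negative energy
    ([low_energy_of_infinite_Lqpow]). That test functions belong to [H01 Om] is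
    integration by parts, which follows from Fubini for the iterated product
    measure ([integral_partial]).

    Strict inequality. Two ground states [v1], [v2] at [lam] have the same action
    and hence the same [P]. The rays through them give two upper bounds of
    [lam * mu + energy_level mu], namely [P * fiber p (mu / mass vi)]. Both have
    the maximum [J lam], strictly attained at [mu = mass vi] only. As the masses
    differ, the minimum of the two bounds stays below [J lam] by a fixed amount
    ([dual_level_lt]).

    Non-convexity. The action level is nonnegative, and finite near [lam] because
    [v1] can be rescaled onto the neighbouring Nehari manifolds. If it were
    convex it would have a supporting line at [lam] and could not exceed its
    biconjugate there ([convex_le_biconjugate]). *)

Local Open Scope classical_set_scope.
Local Open Scope ring_scope.

(** * Integration by parts on row vectors *)

Section row_cons_slices.
Context {R : realType} {n : nat}.
Implicit Types (x : R) (v : 'rV[R]_n) (h : 'rV[R]_n.+1 -> R).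

Lemma row_consD x y v w :
  row_cons (x + y, v + w) = row_cons (x, v) + row_cons (y, w).
Proof.
apply/rowP => i; rewrite !mxE; case: (unliftP ord0 i) => [j|] _ /=.
  by rewrite mxE.
by [].
Qed.

Lemma row_consZ (a x : R) v : row_cons (a * x, a *: v) = a *: row_cons (x, v).
Proof.
apply/rowP => i; rewrite !mxE; case: (unliftP ord0 i) => [j|] _ /=.
  by rewrite mxE.
by [].
Qed.

Lemma row_cons10 : row_cons (1 : R, 0 : 'rV[R]_n) = delta_mx ord0 ord0.
Proof.
apply/rowP => i; rewrite !mxE eqxx /=; case: (unliftP ord0 i) => [j|] -> /=.
  by rewrite !mxE.
by [].
Qed.

Lemma row_cons0delta (j : 'I_n) :
  row_cons (0 : R, delta_mx ord0 j) = delta_mx ord0 (lift ord0 j).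
Proof.
apply/rowP => i; rewrite !mxE eqxx /=; case: (unliftP ord0 i) => [k|] -> /=.
  by rewrite !mxE eqxx /= (inj_eq lift_inj).
by [].
Qed.

Let slice1_rate h v x :
  (fun k : R => k^-1 *: (((fun t => h (row_cons (t, v))) \o shift x) (k *: 1) -
     h (row_cons (x, v)))) =
  (fun k => k^-1 *: ((h \o shift (row_cons (x, v))) (k *: delta_mx ord0 ord0) -
     h (row_cons (x, v)))).
Proof.
apply/funext => k /=; congr (_ *: (h _ - _)).
rewrite -row_cons10 -row_consZ -row_consD scaler0 add0r; congr row_cons.
Qed.

Lemma derive_slice1 h v x :
  'D_1 (fun t => h (row_cons (t, v))) x =
  partial ord0 h (row_cons (x, v)).
Proof. by rewrite /partial /derive slice1_rate. Qed.

Lemma derivable_slice1 h v x : derivable h (row_cons (x, v)) (delta_mx ord0 ord0) ->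
  derivable (fun t => h (row_cons (t, v))) x 1.
Proof. by rewrite /derivable slice1_rate. Qed.

Let slice2_rate h (j : 'I_n) v x :
  (fun k : R => k^-1 *: (((fun w => h (row_cons (x, w))) \o shift v)
     (k *: delta_mx ord0 j) - h (row_cons (x, v)))) =
  (fun k => k^-1 *: ((h \o shift (row_cons (x, v)))
     (k *: delta_mx ord0 (lift ord0 j)) - h (row_cons (x, v)))).
Proof.
apply/funext => k /=; congr (_ *: (h _ - _)).
by rewrite -row_cons0delta -row_consZ -row_consD mulr0 add0r.
Qed.

Lemma partial_slice2 h (j : 'I_n) v x :
  partial j (fun w => h (row_cons (x, w))) v =
  partial (lift ord0 j) h (row_cons (x, v)).
Proof. by rewrite /partial /derive slice2_rate. Qed.

Lemma derivable_slice2 h (j : 'I_n) v x :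
  derivable h (row_cons (x, v)) (delta_mx ord0 (lift ord0 j)) ->
  derivable (fun w => h (row_cons (x, w))) v (delta_mx ord0 j).
Proof. by rewrite /derivable slice2_rate. Qed.

Lemma continuous_row_cons1 v : continuous (fun x : R => row_cons (x, v)).
Proof.
move=> x A /nbhs_ballP[e /= e0 eA]; apply/nbhs_ballP; exists e => //= y xy.
apply: eA; split=> // i j; rewrite !mxE.
by case: (unliftP ord0 j) => [k|] _ /=; [exact: ballxx|].
Qed.

Lemma continuous_row_cons2 x : continuous (fun v => row_cons (x, v)).
Proof.
move=> v A /nbhs_ballP[e /= e0 eA]; apply/nbhs_ballP; exists e => //= w [_ vw].
apply: eA; split=> // i j; rewrite !mxE.
by case: (unliftP ord0 j) => [k|] _ /=; [exact: vw|exact: ballxx].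
Qed.

End row_cons_slices.

Section integral_continuous.
Context {R : realType}.

Lemma continuous_measurable_rV n (f : 'rV[R]_n -> R) :
  continuous f -> measurable_fun setT f.
Proof.
move=> /continuousP cf; apply: (measurability _ (RGenOpens.measurableE R)).
move=> _ [_ [a [b ->] <-]]; rewrite setTI; apply: open_measurable_rV.
exact/cf/interval_open.
Qed.

(** Boxes rather than balls: slicing along a coordinate preserves the property,
    with the same bound. *)
Definition supported_in_box n (M : R) (f : 'rV[R]_n -> R) : Prop :=
  forall (v : 'rV[R]_n) (j : 'I_n), M < `|v ord0 j| -> f v = 0.

Let box n (M : R) : set 'rV[R]_n := [set v | forall j, `[- M, M]%classic (v ord0 j)].

Let box_compact n (M : R) : compact (@box n M).
Proof. by apply: (@rV_compact R n (fun=> `[- M, M]%classic)) => j; exact: segment_compact. Qed.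

Let box_measurable n (M : R) : measurable (@box n M).
Proof.
rewrite (_ : box M = \bigcap_(i in [set: 'I_n])
    ((fun v : 'rV[R]_n => v ord0 i) @^-1` `[- M, M]%classic)); last first.
  by apply/seteqP; split => v /= Bv i; [move=> _; exact: Bv|exact: Bv].
apply: fin_bigcap_measurable => // i _; rewrite -[X in measurable X]setTI.
by apply: measurable_coor_rV.
Qed.

Let box_finite n (M : R) : (lebesgue_rV n (@box n M) < +oo)%E.
Proof.
rewrite (@lebesgue_rV_box _ _ (fun=> `[- M, M]%classic))//.
rewrite (eq_bigr (fun=> (fine (lebesgue_measure `[- M, M]%classic : \bar R))%:E)).
  by rewrite prodEFin ltry.
move=> i _; rewrite fineK//= lebesgue_measure_itv/=; by case: ifP.
Qed.

Lemma continuous_bounded_box n (M : R) (f : 'rV[R]_n -> R) :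
  continuous f -> supported_in_box M f -> exists C, forall v, `|f v| <= C.
Proof.
move=> cf fM.
have /compact_bounded[C [_ fC]] : compact (f @` box M).
  apply: continuous_compact; last exact: box_compact.
  exact: continuous_subspaceT.
exists (`|C| + 1) => v.
have [Bv|] := pselect (box M v).
  by apply: fC; [rewrite ltr_pwDr// ler_norm|exists v].
move=> /existsNP[j]; rewrite /= in_itv /= -ler_norml => /negP; rewrite -ltNge.
by move=> /fM ->; rewrite normr0 addr_ge0.
Qed.

Lemma continuous_box_integrable n (M : R) (f : 'rV[R]_n -> R) :
  continuous f -> supported_in_box M f ->
  (lebesgue_rV n).-integrable setT (EFin \o f).
Proof.
move=> cf fM.
have -> : (EFin \o f) = (EFin \o f) \_ (box M).
  apply/funext => v; rewrite patchE; case: ifPn => //.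
  rewrite notin_setE => /existsNP[j]; rewrite /= in_itv /= -ler_norml.
  by move=> /negP; rewrite -ltNge => /fM ->.
apply/(integrable_mkcond _ (@box_measurable n M)).
apply: measurable_bounded_integrable => //.
- exact: box_measurable.
- exact: box_finite.
- by apply: measurable_funTS; exact: continuous_measurable_rV.
have [C fC] := continuous_bounded_box cf fM.
exists C; split; rewrite ?num_real// => D CD v _.
by apply: (le_trans (fC v)); exact: ltW.
Qed.

Lemma near_supported_in_box n (M : R) (f : 'rV[R]_n -> R)
    (v : 'rV[R]_n) (j : 'I_n) :
  supported_in_box M f -> M < `|v ord0 j| -> \forall w \near v, f w = 0.
Proof.
move=> fM Mv; near=> w; apply: (fM _ j); near: w.
have : ((fun u : 'rV[R]_n => `|u ord0 j|) @ v --> `|v ord0 j|).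
  apply: (@cvg_comp _ _ _ (fun u : 'rV[R]_n => u ord0 j) Num.norm); last exact: norm_continuous.
  exact: (@coord_continuous R 1 n ord0 j v).
by move=> /(_ [set t | M < t]); apply; exact: lt_nbhsr.
Unshelve. all: by end_near. Qed.

Lemma partial_supported_in_box n (M : R) i (f : 'rV[R]_n -> R) :
  supported_in_box M f -> supported_in_box M (partial i f).
Proof.
move=> fM v j Mv; rewrite /partial.
rewrite (@near_eq_derive _ _ _ f (cst 0)) ?derive_cst//.
exact: near_supported_in_box Mv.
Qed.

(** Bounded support makes both boundary terms of the fundamental theorem of
    calculus vanish. *)
Lemma integral_derive_line (g : R -> R) (M : R) :
  (forall x, derivable g x 1) -> continuous (fun x => 'D_1 g x) ->
  (forall x, M < `|x| -> g x = 0) ->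
  (\int[lebesgue_measure]_x ('D_1 g x)%:E)%E = 0%E.
Proof.
move=> dg cg gM.
(* a nonnegative bound strictly beyond [M], so that [g] vanishes at both ends *)
pose a := `|M| + 1.
have Ma : M < a by rewrite /a ltr_pwDr// ler_norm.
have a0 : 0 < a by rewrite /a ltr_wpDl.
have cgg x : {for x, continuous g}.
  exact/differentiable_continuous/derivable1_diffP.
have dg0 x : M < `|x| -> 'D_1 g x = 0.
  move=> Mx; rewrite (@near_eq_derive _ _ _ g (cst 0)) ?derive_cst//.
  near=> y; apply: gM; near: y.
  by have /(_ [set t | M < t]) := @norm_continuous _ _ x; apply; exact: lt_nbhsr.
rewrite (_ : (fun x => _) = (fun x => ('D_1 g x)%:E) \_ `[- a, a]); last first.
  apply/funext => x; rewrite patchE; case: ifPn => //.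
  rewrite notin_setE /= in_itv /= -ler_norml => /negP; rewrite -ltNge => ax.
  by rewrite dg0// (lt_trans Ma).
rewrite -integral_mkcond (@continuous_FTC2 _ _ g).
- rewrite !gM ?subee//.
  + by rewrite normrN gtr0_norm.
  + by rewrite gtr0_norm.
- by rewrite gt0_cp.
- exact: continuous_subspaceT.
- split => //.
  + exact/cvg_at_right_filter/cgg.
  + exact/cvg_at_left_filter/cgg.
- by move=> x _; rewrite derive1E.
Unshelve. all: by end_near. Qed.

(** The measure being an iterated product, Fubini isolates one coordinate at a
    time. The induction peels off the first coordinate: if it is the coordinate
    of differentiation, the inner integral is one-dimensional and vanishes;
    otherwise the inner integral is the same statement for a slice of [h], one
    dimension lower. This is why [h] is only required to be differentiable in
    the direction [i]: slices inherit exactly that. *)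
Lemma integral_partial n (i : 'I_n) (h : 'rV[R]_n -> R) (M : R) :
  continuous h -> (forall v, derivable h v (delta_mx ord0 i)) ->
  continuous (partial i h) -> supported_in_box M h ->
  (\int[lebesgue_rV n]_v (partial i h v)%:E = 0)%E.
Proof.
elim: n i h => [[]//|n IHn] i h ch dh cph hM.
have cih : (lebesgue_rV n.+1).-integrable setT (EFin \o partial i h).
  exact: (continuous_box_integrable cph (partial_supported_in_box i hM)).
have mph : measurable_fun setT (EFin \o partial i h) by exact: measurable_int cih.
pose F (z : measurableTypeR R * 'rV[R]_n) := (partial i h (row_cons z))%:E.
have mF : measurable_fun setT F.
  exact: (measurableT_comp mph (@measurable_row_cons R n)).
have iF : (lebesgue_measure \x lebesgue_rV n)%E.-integrable setT F.
  apply/integrableP; split => //.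
  move/integrableP: cih => [_]; rewrite /= /lebesgue_succ.
  rewrite ge0_integral_pushforward//; first exact: measurable_row_cons.
  by apply/measurable_EFinP; apply: measurableT_comp => //; exact: continuous_measurable_rV.
rewrite /= /lebesgue_succ integral_pushforward//; last exact: measurable_row_cons.
rewrite preimage_setT.
case: (unliftP ord0 i) => [j|] ij.
  rewrite -(integral12_prod_meas1 iF) /fubini_F; apply: integral0_eq => x _.
  rewrite /F ij /=; under eq_integral do rewrite -partial_slice2.
  apply: (IHn j (fun w => h (row_cons (x, w)))) => /=.
  - by move=> v; apply: continuous_comp; [exact: continuous_row_cons2|exact: ch].
  - by move=> v; apply: derivable_slice2; rewrite -ij; exact: dh.
  - rewrite (_ : partial _ _ = fun v => partial i h (row_cons (x, v))).
      by move=> v; apply: continuous_comp; [exact: continuous_row_cons2|exact: cph].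
    by apply/funext => v; rewrite partial_slice2 ij.
  - by move=> v k Mk; apply: (hM _ (lift ord0 k)); rewrite row_consS.
rewrite -(integral21_prod_meas1 iF) /fubini_G; apply: integral0_eq => v _.
rewrite /F ij /=; under eq_integral do rewrite -derive_slice1.
apply: (integral_derive_line (M := M)).
- by move=> x; apply: derivable_slice1; rewrite -ij; exact: dh.
- rewrite (_ : (fun x => _) = fun x => partial i h (row_cons (x, v))).
    by move=> x; apply: continuous_comp; [exact: continuous_row_cons1|exact: cph].
  by apply/funext => x; rewrite derive_slice1 ij.
- by move=> x Mx; apply: (hM _ ord0); rewrite row_cons0.
Qed.

End integral_continuous.

(** * Norms as integrals *)

Section Lq_integrals.
Context {R : realType} {N : nat} (Om : set 'rV[R]_N).
Hypothesis mOm : measurable Om.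
Local Notation E := 'rV[R]_N.
Local Notation leb := (lebesgue_rV N).
Implicit Types (u f h : E -> R) (G : E -> E) (q t : R).

(** All functionals are powers of norms; expressed as integrals over [Om] they
    become additive in the integrand. *)
Lemma Lq_pow q u : q != 0 ->
  (Lq Om q u `^ q = \int[leb]_(x in Om) (`|u x| `^ q)%:E)%E.
Proof.
move=> q0; rewrite /Lq poweR_Lnorm// [RHS]integral_mkcond.
apply: eq_integral => x _; rewrite /= !patchE.
by case: ifPn => //= _; rewrite normr0 powR0.
Qed.

Lemma Lq_sqr u :
  (Lq Om 2 u `^ 2 = \int[leb]_(x in Om) (u x ^+ 2)%:E)%E.
Proof.
rewrite Lq_pow//; apply: eq_integral => x _.
by rewrite powR_mulrn// real_normK// num_real.
Qed.

Lemma measurable_powRn u q : measurable_fun Om u ->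
  measurable_fun Om (fun x => `|u x| `^ q).
Proof.
move=> mu; apply: (measurableT_comp (measurable_powR q)).
exact: measurableT_comp.
Qed.

Lemma Lq_powZ q t u : q != 0 -> measurable_fun Om u ->
  (Lq Om q (fun x => t * u x)%R `^ q = (`|t| `^ q)%:E * Lq Om q u `^ q)%E.
Proof.
move=> q0 mu; rewrite !Lq_pow// -ge0_integralZl_EFin//.
  by apply: eq_integral => x _; rewrite normrM powRM// EFinM.
by apply/measurable_EFinP; exact: measurable_powRn.
Qed.

Lemma Lq_ge0 q u : (0 <= Lq Om q u)%E.
Proof. exact: Lnorm_ge0. Qed.

Lemma Lq2_lt u (e : R) : 0 < e ->
  (Lq Om 2 u < e%:E)%E <->
  (\int[leb]_(x in Om) (u x ^+ 2)%:E < (e ^+ 2)%:E)%E.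
Proof.
move=> e0; rewrite -Lq_sqr; have := Lq_ge0 2 u.
case: (Lq Om 2 u) => [r| |]; rewrite ?lee_fin// => r0.
  by rewrite poweR_EFin powR_mulrn// !lte_fin ltr_pXn2r// nnegrE// ltW.
by rewrite poweRyr//; split; rewrite lt_leAnge leey andbF.
Qed.

Lemma Lq2_fin_num u :
  (Lq Om 2 u \is a fin_num) =
  (\int[leb]_(x in Om) (u x ^+ 2)%:E < +oo)%E.
Proof.
rewrite -Lq_sqr; have := Lq_ge0 2 u.
case: (Lq Om 2 u) => [r| |]// _; first by rewrite poweR_EFin !ltry.
by rewrite poweRyr.
Qed.

Lemma inL2P u : inL2 Om u <->
  measurable_fun Om u /\ (\int[leb]_(x in Om) (u x ^+ 2)%:E < +oo)%E.
Proof.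
have E1 : (Lnorm leb 2 (EFin \o u \_ Om) < +oo)%E =
    (\int[leb]_(x in Om) (u x ^+ 2)%:E < +oo)%E.
  rewrite -Lq2_fin_num ge0_fin_numE//; exact: Lq_ge0.
rewrite /inL2; split.
  rewrite inE => /andP[]; rewrite !inE /= => /(measurable_restrictT u mOm) mu.
  by rewrite /finite_norm E1.
move=> [mu u2]; rewrite inE; apply/andP; split; rewrite !inE /=.
  exact/(measurable_restrictT u mOm).
by rewrite /finite_norm E1.
Qed.

Lemma enorm_sqr (v : E) : enorm v ^+ 2 = \sum_i v ord0 i ^+ 2.
Proof. by rewrite sqr_sqrtr// sumr_ge0// => i _; exact: sqr_ge0. Qed.

Lemma measurable_enorm G : (forall i, measurable_fun Om (fun x => G x ord0 i)) ->
  measurable_fun Om (enorm \o G).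
Proof.
move=> mG.
rewrite (_ : _ \o _ = Num.sqrt \o (fun x => \sum_i G x ord0 i ^+ 2))//.
apply: measurableT_comp.
  by apply: continuous_measurable_fun; exact: sqrt_continuous.
by apply: measurable_sum => i; exact: measurable_funX.
Qed.

Lemma integral_enorm_lty G : (forall i, inL2 Om (fun x => G x ord0 i)) ->
  (\int[leb]_(x in Om) ((enorm \o G) x ^+ 2)%:E < +oo)%E.
Proof.
move=> G2; under eq_integral do rewrite /= enorm_sqr -sumEFin.
rewrite ge0_integral_sum//.
- by apply/lte_sum_pinfty => i _; have /inL2P[] := G2 i.
- move=> i; apply/measurable_EFinP; apply: measurable_funX.
  by have /inL2P[] := G2 i.
- by move=> i x _; rewrite lee_fin sqr_ge0.
Qed.

End Lq_integrals.

(** * Test functions *)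

Section test_functions.
Context {R : realType} {N : nat}.
Local Notation E := 'rV[R]_N.
Implicit Types (f g : E -> R) (Om : set E).

Lemma smooth_differentiable f x : smooth f -> differentiable f x.
Proof. by move=> /(_ [::] x). Qed.

Lemma smooth_partial f i : smooth f -> smooth (partial i f).
Proof. by move=> sf s x; have := sf (rcons s i) x; rewrite foldr_rcons. Qed.

Lemma smooth_continuous f : smooth f -> continuous f.
Proof. by move=> sf x; exact/differentiable_continuous/smooth_differentiable. Qed.

Lemma smooth_derivable f x v : smooth f -> derivable f x v.
Proof. by move=> sf; exact/diff_derivable/smooth_differentiable. Qed.

Lemma partialZ (t : R) f i : (forall x, derivable f x (delta_mx ord0 i)) ->
  partial i (fun x => t * f x) = fun x => t * partial i f x.
Proof.
by move=> df; apply/funext => x; exact: (deriveZ t (df x)).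
Qed.

Lemma smoothZ (t : R) f : smooth f -> smooth (fun x => t * f x).
Proof.
move=> sf s x.
have -> : foldr (@partial R N) (fun x => t * f x) s =
    fun x => t * foldr (@partial R N) f s x.
  elim: s => //= i s ->; rewrite partialZ// => y.
  exact/diff_derivable/sf.
exact: (differentiableZ t (sf s x)).
Qed.

Lemma test_functionZ (t : R) Om f :
  test_function Om f -> test_function Om (fun x => t * f x).
Proof.
move=> [sf cf fOm].
have sub : closure [set x | t * f x != 0] `<=` closure [set x | f x != 0].
  by apply: closureS => x /=; apply: contraNN => /eqP ->; rewrite mulr0.
split; first exact: smoothZ.
- by apply: subclosed_compact cf sub; exact: closed_closure.
- exact: subset_trans fOm.
Qed.

Lemma test_function_eq0 Om f x : test_function Om f -> ~ Om x -> f x = 0.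
Proof.
move=> [_ _ fOm] Omx; apply/eqP; apply: contrapT => /negP fx0.
by apply: Omx; apply: fOm; exact: subset_closure.
Qed.

Lemma test_function_supported Om f : test_function Om f ->
  exists M, supported_in_box M f.
Proof.
move=> [_ /compact_bounded[M [_ MP]] _]; exists (`|M| + 1) => v j Mv.
apply/eqP; apply: contraLR Mv => fv0; rewrite -leNgt.
have vM : `|v| <= `|M| + 1.
  by apply: MP; [rewrite ltr_pwDr// ler_norm|exact: subset_closure].
apply: le_trans vM.
rewrite [leRHS]/Num.norm /= mx_normrE; apply/bigmax_geP; right => /=.
by exists (ord0, j).
Qed.

(** Integration by parts: [f * g] is continuously differentiable with bounded
    support, so the integral of its partial derivative vanishes. *)
Lemma test_function_weak_gradient Om f : measurable Om ->
  test_function Om f -> weak_gradient Om f (gradient f).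
Proof.
move=> mOm tf g tg i.
have [[sf _ _] [sg _ _]] := (tf, tg).
have [M fM] := test_function_supported tf.
pose h x := f x * g x.
have cf := smooth_continuous sf.
have cg := smooth_continuous sg.
have cpf := smooth_continuous (smooth_partial i sf).
have cpg := smooth_continuous (smooth_partial i sg).
have dh x : derivable h x (delta_mx ord0 i).
  by apply: derivableM; exact: smooth_derivable.
have phE : partial i h = fun x => f x * partial i g x + partial i f x * g x.
  apply/funext => x.
  rewrite /partial (_ : h = f * g)//.
  rewrite (deriveM (smooth_derivable sf) (smooth_derivable sg)).
  by rewrite /GRing.scale /= [g x * _]mulrC.
have c1 : continuous (fun x => f x * partial i g x).
  by move=> x; exact: (continuousM (@cf x) (@cpg x)).
have c2 : continuous (fun x => partial i f x * g x).
  by move=> x; exact: (continuousM (@cpf x) (@cg x)).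
have i1 : (lebesgue_rV N).-integrable setT (EFin \o (fun x => f x * partial i g x)).
  by apply: continuous_box_integrable c1 _ => v j /fM ->; rewrite mul0r.
have i2 : (lebesgue_rV N).-integrable setT (EFin \o (fun x => partial i f x * g x)).
  apply: (continuous_box_integrable (M := M) c2) => v j Mv.
  by rewrite (partial_supported_in_box i fM Mv) mul0r.
have : \int[lebesgue_rV N]_x (partial i h x) = 0.
  rewrite /Rintegral (integral_partial _ _ _ (M := M))//.
  - by move=> x; exact: (continuousM (@cf x) (@cg x)).
  - by rewrite phE => x; exact: (continuousD (@c1 x) (@c2 x)).
  - by move=> v j /fM; rewrite /h => ->; rewrite mul0r.
rewrite phE RintegralD// => /eqP; rewrite addr_eq0 => /eqP IBP.
rewrite Rintegral_mkcond [in RHS]Rintegral_mkcond.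
rewrite (_ : _ \_ _ = fun x => f x * partial i g x); last first.
  apply/funext => x; rewrite patchE; case: ifPn => //; rewrite notin_setE => nOx.
  by rewrite (test_function_eq0 tf nOx) mul0r.
rewrite IBP; congr (- _); congr Rintegral.
apply/funext => x; rewrite patchE; case: ifPn => [_|]; first by rewrite mxE.
by rewrite notin_setE => nOx; rewrite (test_function_eq0 tg nOx) mulr0.
Qed.

End test_functions.

(** * Tangent lines of powers *)

Section powR_convexity.
Context {R : realType}.
Implicit Types a b r x y T : R.

(** The graph of a convex power lies above its tangent line at [a]. This is
    Young's inequality for [a `^ (r - 1)] and [b], with exponents
    [r / (r - 1)] and [r]. *)
Lemma powR_tangent a b r : 1 < r -> 0 <= a -> 0 <= b ->
  a `^ r + r * a `^ (r - 1) * (b - a) <= b `^ r.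
Proof.
move=> r1 a0 b0.
have r0 : 0 < r by rewrite (lt_trans ltr01).
have rm0 : 0 < r - 1 by rewrite subr_gt0.
have conj : (r / (r - 1))^-1 + r^-1 = 1 by field; rewrite !gt_eqF.
have := conjugate_powR (powR_ge0 a (r - 1)) b0 (divr_gt0 r0 rm0) r0 conj.
rewrite -powRrM (_ : (r - 1) * (r / (r - 1)) = r); last first.
  by rewrite mulrC divfK// gt_eqF.
have aE : a `^ (r - 1) * a = a `^ r.
  have [->|an0] := eqVneq a 0; first by rewrite mulr0 powR0// gt_eqF.
  rewrite -{2}(powRr1 a0) -powRD ?subrK//.
  by rewrite an0 implybT.
move=> young.
have : r * (a `^ (r - 1) * b) <= (r - 1) * a `^ r + b `^ r.
  have := ler_wpM2l (ltW r0) young; congr (_ <= _).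
  by field; rewrite !gt_eqF.
rewrite mulrBr -[r * _ * a]mulrA aE -[r * _ * b]mulrA.
by move=> ?; lra.
Qed.

(** A lower bound of [|f| ^ p] that only sees [u - f] through its square: the
    tangent inequality at the truncation of [|u|] produces an error linear in
    [|u - f|] with slope at most [p * T ^ (p - 1)], and AM-GM turns it into a
    square plus a constant. The constant is harmless on a set of finite
    measure. *)
Lemma truncated_powR_le (p T u f : R) : 1 < p -> 0 <= T ->
  Num.min `|u| T `^ p <=
  `|f| `^ p + (1 + (p * T `^ (p - 1)) ^+ 2 * (u - f) ^+ 2).
Proof.
move=> p1 T0; set a := Num.min _ _.
have a0 : 0 <= a by rewrite le_min normr_ge0.
have p0 : 0 < p by rewrite (lt_trans ltr01).
have aT : a <= T by rewrite ge_min lexx orbT.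
have au : a <= `|u| by rewrite ge_min lexx.
have := powR_tangent p1 a0 (normr_ge0 f).
set c := p * T `^ (p - 1).
have c'0 : 0 <= p * a `^ (p - 1) by rewrite mulr_ge0// ?powR_ge0// ltW.
have c'c : p * a `^ (p - 1) <= c.
  by rewrite ler_pM2l// ge0_ler_powR// subr_ge0 ltW.
have ab : a - `|f| <= `|u - f|.
  by apply: le_trans (ler_dist_dist _ _); apply: le_trans (ler_norm _); rewrite lerB.
move=> tangent.
have step : p * a `^ (p - 1) * (a - `|f|) <= c * `|u - f|.
  apply: (@le_trans _ _ (p * a `^ (p - 1) * `|u - f|)).
    exact: ler_wpM2l.
  exact: ler_wpM2r.
have amgm : c * `|u - f| <= 1 + c ^+ 2 * (u - f) ^+ 2.
  rewrite -(real_normK (num_real (u - f))); nra.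
nra.
Qed.

End powR_convexity.

(** * Elements of the Sobolev space *)

Section H01_constructions.
Context {R : realType} {N : nat} (Om : set 'rV[R]_N).
Hypothesis mOm : measurable Om.
Local Notation E := 'rV[R]_N.
Local Notation leb := (lebesgue_rV N).
Implicit Types (u : H01 Om) (f g h : E -> R) (q t : R).

Lemma bounded_powR_lty q h C : (leb Om < +oo)%E -> 0 <= q ->
  measurable_fun Om h -> (forall x, `|h x| <= C) ->
  (\int[leb]_(x in Om) (`|h x| `^ q)%:E < +oo)%E.
Proof.
move=> Omoo q0 mh hC.
have C0 : 0 <= C := le_trans (normr_ge0 _) (hC 0).
apply: (@le_lt_trans _ _ (\int[leb]_(x in Om) (cst (C `^ q)%:E x))%E).
  apply: ge0_le_integral => //=.
  - by apply/measurable_EFinP; exact: measurable_powRn.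
  - by move=> x _; rewrite lee_fin ge0_ler_powR// ?nnegrE// (le_trans (normr_ge0 _) (hC x)).
by rewrite integral_cst// lte_mul_pinfty// lee_fin powR_ge0.
Qed.

Lemma test_function_measurable f : test_function Om f -> measurable_fun Om f.
Proof.
move=> [sf _ _]; apply: measurable_funTS; apply: continuous_measurable_rV.
exact: smooth_continuous.
Qed.

Lemma test_function_partial_measurable f i :
  test_function Om f -> measurable_fun Om (partial i f).
Proof.
move=> [sf _ _]; apply: measurable_funTS; apply: continuous_measurable_rV.
exact/smooth_continuous/smooth_partial.
Qed.

Lemma continuous_box_inL2 f M : (leb Om < +oo)%E -> continuous f ->
  supported_in_box M f -> inL2 Om f.
Proof.
move=> Omoo cf fM; apply/inL2P => //.
have mf : measurable_fun Om f.
  by apply: measurable_funTS; exact: continuous_measurable_rV.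
split=> //; have [C fC] := continuous_bounded_box cf fM.
rewrite -Lq_sqr Lq_pow//; exact: bounded_powR_lty fC.
Qed.

Section test_H01.
Variables (f : E -> R) (tf : test_function Om f) (Omoo : (leb Om < +oo)%E).

Let f_L2 : inL2 Om f.
Proof.
have [M fM] := test_function_supported tf; have [sf _ _] := tf.
exact: (continuous_box_inL2 Omoo (smooth_continuous sf) fM).
Qed.

Let gradf_L2 i : inL2 Om (fun x => gradient f x ord0 i).
Proof.
have [M fM] := test_function_supported tf; have [sf _ _] := tf.
rewrite (_ : (fun x => _) = partial i f); last by apply/funext => x; rewrite mxE.
exact: (continuous_box_inL2 Omoo (smooth_continuous (smooth_partial i sf))
  (partial_supported_in_box i fM)).
Qed.

Let f_closure e : 0 < e -> exists2 g, test_function Om g &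
    (Lq Om 2 (f \- g)%R < e%:E)%E /\
    (Lq Om 2 (fun x => enorm (gradient f x - gradient g x)%R) < e%:E)%E.
Proof.
move=> e0; exists f => //; split; apply/(Lq2_lt _ _ e0) => //.
  rewrite integral0_eq ?lte_fin ?exprn_gt0// => x _.
  by rewrite /= subrr expr0n.
rewrite integral0_eq ?lte_fin ?exprn_gt0// => x _.
by rewrite subrr enorm_sqr big1// => i _; rewrite mxE expr0n.
Qed.

(** Test functions are elements of [H01 Om]; together with the multiples of
    given elements they are the only competitors used. *)
Definition test_H01 : H01 Om :=
  MkH01 f_L2 gradf_L2 (test_function_weak_gradient mOm tf) f_closure.

End test_H01.

Lemma H01_measurable u : measurable_fun Om u.
Proof. by have /inL2P[] := h01_funL2 u. Qed.

Lemma H01_grad_measurable u i : measurable_fun Om (fun x => h01_grad u x ord0 i).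
Proof. by have /inL2P[] := h01_gradL2 u i. Qed.

Lemma enormZ t (v : E) : enorm (t *: v) = `|t| * enorm v.
Proof.
rewrite /enorm -sqrtr_sqr -sqrtrM ?sqr_ge0// mulr_sumr.
by congr Num.sqrt; apply: eq_bigr => i _; rewrite mxE exprMn.
Qed.

Section scale_H01.
Variables (t : R) (u : H01 Om).

Let tu_L2 h : inL2 Om h -> inL2 Om (fun x => t * h x).
Proof.
move=> /inL2P => /(_ mOm)[mh h2]; apply/inL2P => //; split.
  exact: measurable_funM.
rewrite -Lq_sqr Lq_powZ// Lq_sqr lte_mul_pinfty// lee_fin powR_ge0//.
Qed.

Let tu_gradL2 i : inL2 Om (fun x => (t *: h01_grad u x) ord0 i).
Proof.
rewrite (_ : (fun x => _) = fun x => t * h01_grad u x ord0 i).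
  exact/tu_L2/h01_gradL2.
by apply/funext => x; rewrite mxE.
Qed.

(* The identity for [u] against [t * f] absorbs the factor without pulling it
   out of an integral. *)
Let tu_weak : weak_gradient Om (fun x => t * u x) (fun x => t *: h01_grad u x).
Proof.
move=> f tf i; have [sf _ _] := tf.
have := h01_weak u (test_functionZ t tf) i.
rewrite partialZ => [IBP|x]; last exact: smooth_derivable.
under eq_Rintegral do rewrite mulrAC mulrC.
rewrite IBP; congr (- _); apply: eq_Rintegral => x _.
by rewrite mxE mulrCA mulrA.
Qed.

Let tu_closure e : 0 < e -> exists2 f, test_function Om f &
    (Lq Om 2 ((fun x => t * u x) \- f)%R < e%:E)%E /\
    (Lq Om 2 (fun x => enorm (t *: h01_grad u x - gradient f x)%R) < e%:E)%E.
Proof.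
(* the [+ 1] keeps the radius meaningful when [t = 0] *)
move=> e0; have e'0 : 0 < e / (`|t| + 1) by rewrite divr_gt0// ltr_wpDl.
have t2e : t ^+ 2 * (e / (`|t| + 1)) ^+ 2 < e ^+ 2.
  rewrite -exprMn -real_normK ?num_real// normrM (gtr0_norm e'0).
  rewrite ltr_pXn2r ?nnegrE ?mulr_ge0 ?(ltW e'0) ?(ltW e0)//.
  by rewrite mulrCA gtr_pMr// ltr_pdivrMr ?mul1r ?ltrDl// ltr_wpDl.
have scaled h : measurable_fun Om h -> (Lq Om 2 h < (e / (`|t| + 1))%:E)%E ->
    (Lq Om 2 (fun x => t * h x)%R < e%:E)%E.
  move=> mh /(Lq2_lt _ _ e'0) he; apply/(Lq2_lt _ _ e0).
  rewrite -Lq_sqr Lq_powZ// Lq_sqr powR_mulrn// real_normK ?num_real//.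
  apply: (@le_lt_trans _ _ ((t ^+ 2)%:E * ((e / (`|t| + 1)) ^+ 2)%:E)%E).
    by apply: lee_wpmul2l; [rewrite lee_fin sqr_ge0|exact: ltW].
  by rewrite -EFinM lte_fin.
have [f tf [uf Guf]] := h01_closure u e'0.
exists (fun x => t * f x); first exact: test_functionZ.
have mf := test_function_measurable tf.
split.
  rewrite (_ : _ \- _ = fun x => t * (u \- f) x).
    by apply: scaled => //; apply: measurable_funB => //; exact: H01_measurable.
  by apply/funext => x /=; rewrite mulrBr.
have mG : measurable_fun Om (fun x => enorm (h01_grad u x - gradient f x)).
  apply: (@measurable_enorm _ _ _ (fun x => h01_grad u x - gradient f x)) => i.
  rewrite (_ : (fun x => _) = fun x => h01_grad u x ord0 i - partial i f x).
    apply: measurable_funB; first exact: H01_grad_measurable.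
    exact: test_function_partial_measurable.
  by apply/funext => x; rewrite !mxE.
have := scaled _ mG Guf; rewrite !Lq2_lt//; congr (_ < _)%E.
apply: eq_integral => x _; have [sf _ _] := tf.
have -> : gradient (fun y => t * f y) x = t *: gradient f x.
  by apply/rowP => i; rewrite !mxE partialZ// => y; exact: smooth_derivable.
by rewrite -scalerBr enormZ !exprMn real_normK ?num_real.
Qed.

(** The rays [t *: u] are the curves along which all three functionals are
    homogeneous. *)
Definition scale_H01 : H01 Om :=
  MkH01 (tu_L2 (h01_funL2 u)) tu_gradL2 tu_weak tu_closure.

Lemma Lqpow_scale q : q != 0 ->
  Lqpow q scale_H01 = ((`|t| `^ q)%:E * Lqpow q u)%E.
Proof. by move=> q0; rewrite /Lqpow Lq_powZ//; exact: H01_measurable. Qed.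

Lemma dirichlet_scale : dirichlet scale_H01 = ((t ^+ 2)%:E * dirichlet u)%E.
Proof.
rewrite /dirichlet (_ : enorm \o _ = fun x => `|t| * (enorm \o h01_grad u) x).
  rewrite Lq_powZ// ?normr_id ?powR_mulrn// ?real_normK ?num_real//.
  by apply: measurable_enorm => i; exact: H01_grad_measurable.
by apply/funext => x /=; rewrite enormZ.
Qed.

End scale_H01.

Lemma dirichlet_fin_num u : dirichlet u \is a fin_num.
Proof.
rewrite ge0_fin_numE ?poweR_ge0// /dirichlet Lq_sqr//.
by apply: integral_enorm_lty => // i; exact: h01_gradL2.
Qed.

Lemma Lqpow2_fin_num u : Lqpow 2 u \is a fin_num.
Proof.
rewrite ge0_fin_numE ?poweR_ge0// /Lqpow Lq_sqr//.
by have /inL2P[] := h01_funL2 u.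
Qed.

Lemma test_H01_Lqpow_lty q f (tf : test_function Om f) (Omoo : (leb Om < +oo)%E) :
  0 < q -> (Lqpow q (test_H01 tf Omoo) < +oo)%E.
Proof.
move=> q0; have [M fM] := test_function_supported tf; have [sf _ _] := tf.
have [C fC] := continuous_bounded_box (smooth_continuous sf) fM.
rewrite /Lqpow Lq_pow ?gt_eqF//.
by apply: bounded_powR_lty fC => //; [exact: ltW|exact: test_function_measurable].
Qed.

End H01_constructions.

(** * Elements of infinite norm *)

Section approximation.
Context {R : realType} {N : nat} (Om : set 'rV[R]_N).
Hypothesis mOm : measurable Om.
Hypothesis Omoo : (lebesgue_rV N Om < +oo)%E.
Local Notation E := 'rV[R]_N.
Local Notation leb := (lebesgue_rV N).
Implicit Types (u w : H01 Om) (f g h : E -> R) (p q t : R).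

Lemma integral_sqr_le (a b c : E -> R) :
  measurable_fun Om a -> measurable_fun Om b -> measurable_fun Om c ->
  (forall x, a x ^+ 2 <= 2 * b x ^+ 2 + 2 * c x ^+ 2) ->
  (\int[leb]_(x in Om) (a x ^+ 2)%:E <=
   2%:E * \int[leb]_(x in Om) (b x ^+ 2)%:E +
   2%:E * \int[leb]_(x in Om) (c x ^+ 2)%:E)%E.
Proof.
move=> ma mb mc abc.
have mb2 : measurable_fun Om (fun x => (b x ^+ 2)%:E).
  by apply/measurable_EFinP; exact: measurable_funX.
have mc2 : measurable_fun Om (fun x => (c x ^+ 2)%:E).
  by apply/measurable_EFinP; exact: measurable_funX.
rewrite -!ge0_integralZl_EFin//; last 2 first.
- by move=> x _; rewrite lee_fin sqr_ge0.
- by move=> x _; rewrite lee_fin sqr_ge0.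
rewrite -ge0_integralD//; last 4 first.
- by move=> x _; rewrite -EFinM lee_fin mulr_ge0// sqr_ge0.
- exact: measurable_funeM.
- by move=> x _; rewrite -EFinM lee_fin mulr_ge0// sqr_ge0.
- exact: measurable_funeM.
apply: ge0_le_integral => //=.
- by move=> x _; rewrite lee_fin sqr_ge0.
- by apply/measurable_EFinP; exact: measurable_funX.
- by apply: emeasurable_funD; exact: measurable_funeM.
- by move=> x _; rewrite -!EFinM -EFinD lee_fin.
Qed.

Lemma sqr_le_split (x y : R) : x ^+ 2 <= 2 * y ^+ 2 + 2 * (y - x) ^+ 2.
Proof. by have := sqr_ge0 (2 * y - x); nra. Qed.

Lemma enorm_sqr_le_split (v w : E) :
  enorm v ^+ 2 <= 2 * enorm w ^+ 2 + 2 * enorm (w - v) ^+ 2.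
Proof.
rewrite !enorm_sqr !mulr_sumr -big_split /=; apply: ler_sum => i _.
by rewrite !mxE; exact: sqr_le_split.
Qed.

Lemma measurable_truncation p u T :
  measurable_fun Om (fun x => Num.min `|u x| T `^ p).
Proof.
apply: (measurableT_comp (measurable_powR p)).
apply: measurable_minr => //; apply: measurableT_comp => //.
exact: H01_measurable.
Qed.

(** Monotone convergence of the truncations to [|u| ^ p]. *)
Lemma truncation_unbounded p u (A : R) : 0 < p -> Lqpow p u = +oo%E ->
  exists2 T, 0 <= T &
    (A%:E < \int[leb]_(x in Om) (Num.min `|u x| T `^ p)%:E)%E.
Proof.
move=> p0 uoo.
pose g (n : nat) x := (Num.min `|u x| n%:R `^ p)%:E.
have g0 n x : (0 <= g n x)%E by rewrite lee_fin powR_ge0.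
have mg n : measurable_fun Om (g n).
  by apply/measurable_EFinP; exact: measurable_truncation.
have ndg x : {homo g^~ x : n m / (n <= m)%N >-> (n <= m)%E}.
  move=> n m nm; rewrite lee_fin ge0_ler_powR ?(ltW p0)// ?nnegrE ?le_min ?normr_ge0//=.
  by rewrite !ge_min lexx ler_nat nm !orbT.
have := @cvg_monotone_convergence _ _ _ leb Om mOm g mg (fun n x _ => g0 n x) (fun x _ => ndg x).
rewrite (_ : (\int[leb]_(x in Om) limn (g^~ x))%E = +oo%E); last first.
  rewrite -uoo /Lqpow Lq_pow ?gt_eqF//; apply: eq_integral => x _.
  apply/cvg_lim => //; apply: cvg_near_cst.
  near=> n; rewrite /g; congr (_ `^ _)%:E; apply/min_idPl.
  by near: n; exact: nbhs_infty_ger.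
move=> /cvgey_gt/(_ A)[n _ /(_ n)] /= Ag.
by exists n%:R => //; exact: Ag.
Unshelve. all: by end_near. Qed.

(** An [L^2]-small perturbation of [u] has an [L^p]-norm at least as large as
    that of a truncation of [u], up to the measure of [Om] and the [L^2]-error. *)
Lemma truncation_le p u f (T : R) : 1 < p -> 0 <= T -> measurable_fun Om f ->
  (\int[leb]_(x in Om) (Num.min `|u x| T `^ p)%:E <=
   Lq Om p f `^ p + (leb Om + ((p * T `^ (p - 1)) ^+ 2)%:E *
     \int[leb]_(x in Om) ((u \- f) x ^+ 2)%:E))%E.
Proof.
move=> p1 T0 mf; set c := p * _.
have muf : measurable_fun Om (fun x => ((u \- f) x ^+ 2)%:E).
  apply/measurable_EFinP; apply: measurable_funX; apply: measurable_funB => //.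
  exact: H01_measurable.
have mfp : measurable_fun Om (fun x => (`|f x| `^ p)%:E).
  by apply/measurable_EFinP; exact: measurable_powRn.
have muf' : measurable_fun Om (fun x => (c ^+ 2)%:E * ((u \- f) x ^+ 2)%:E)%E.
  exact: measurable_funeM.
have p0 : p != 0 by rewrite gt_eqF// (lt_trans ltr01).
rewrite Lq_pow// -ge0_integralZl_EFin ?sqr_ge0//; last first.
  by move=> x _; rewrite lee_fin sqr_ge0.
rewrite -[leb Om]mul1e -integral_cst//= -ge0_integralD//; last first.
  by move=> x _; rewrite -EFinM lee_fin mulr_ge0 ?sqr_ge0.
rewrite -ge0_integralD//; last 2 first.
- by move=> x _; rewrite -EFinM -EFinD lee_fin addr_ge0// mulr_ge0 ?sqr_ge0.
- exact: emeasurable_funD.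
apply: ge0_le_integral => //.
- by move=> x _; rewrite lee_fin powR_ge0.
- by apply/measurable_EFinP; exact: measurable_truncation.
- by apply: emeasurable_funD => //; exact: emeasurable_funD.
- by move=> x _; rewrite -EFinM -!EFinD lee_fin; exact: truncated_powR_le.
Qed.

(** An element with infinite [L^p]-norm has energy [-oo] but lies on no Nehari
    manifold; it is replaced here by elements of the same mass with finite but
    very negative energy. Test functions close to [u] in [H^1] have a bounded
    Dirichlet integral and an arbitrarily large [L^p]-norm, by [truncation_le]
    with a large truncation level. Multiplying by [s], between [1/2] and [2],
    restores the mass. *)
Lemma low_energy_of_infinite_Lqpow p u (K : R) : 1 < p -> (0 < Lqpow 2 u)%E ->
  Lqpow p u = +oo%E ->
  exists w, [/\ Lqpow 2 w = Lqpow 2 u, (Lqpow p w < +oo)%E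
    & (energy p w <= K%:E)%E].
Proof.
move=> p1 u0 uoo.
have p0 : 0 < p by rewrite (lt_trans ltr01).
have [m mE] : exists m, Lqpow 2 u = m%:E.
  by exists (fine (Lqpow 2 u)); rewrite fineK ?Lqpow2_fin_num.
have [d dE] : exists d, dirichlet u = d%:E.
  by exists (fine (dirichlet u)); rewrite fineK ?dirichlet_fin_num.
have [V VE] : exists V, leb Om = V%:E.
  by exists (fine (leb Om)); rewrite fineK ?ge0_fin_numE.
have m0 : 0 < m by rewrite -lte_fin -mE.
have d0 : 0 <= d by rewrite -lee_fin -dE poweR_ge0.
have h0 : 0 < 2^-1 `^ p :> R by rewrite powR_gt0.
(* a lower bound of the [p]-th power of the [L^p]-norm that forces the energy
   below [K], as the Dirichlet part is at most [4 * (2 * d + 2) / 2] *)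
pose B := p * (`|K| + (4 * d + 4)) / 2^-1 `^ p.
have B0 : 0 <= B.
  apply: divr_ge0; last exact: ltW.
  by apply: mulr_ge0; [exact: ltW|have := normr_ge0 K; lra].
have [T T0 AT] := truncation_unbounded (B + V + 1) p0 uoo.
pose c := p * T `^ (p - 1).
(* the bounds by [m / 4] and [(1 + c ^+ 2)^-1] control the mass of the test
   function and the error term of [truncation_le] *)
pose eta := Num.min (Num.min 1 (m / 4)) (1 + c ^+ 2)^-1.
have c0 : 0 <= c ^+ 2 by rewrite sqr_ge0.
have eta0 : 0 < eta.
  by rewrite !lt_min ltr01 divr_gt0//= invr_gt0 ltr_wpDr.
have eta1 : eta <= 1 by rewrite !ge_min lexx.
have etam : eta <= m / 4 by rewrite !ge_min lexx !orbT.
have etac : c ^+ 2 * eta <= 1.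
  have : eta * (1 + c ^+ 2) <= 1.
    by rewrite -ler_pdivlMr ?ltr_wpDr// mul1r !ge_min lexx !orbT.
  by rewrite mulrDr mulr1 mulrC; apply: le_trans; rewrite lerDr ltW.
have e0 : 0 < Num.sqrt eta by rewrite sqrtr_gt0.
have [f tf []] := h01_closure u e0.
move=> /(Lq2_lt _ _ e0) + /(Lq2_lt _ _ e0); rewrite sqr_sqrtr ?ltW// => uf Guf.
pose v := test_H01 mOm tf Omoo.
have mf := test_function_measurable tf.
have mu := H01_measurable mOm u.
have [mv mvE] : exists m, Lqpow 2 v = m%:E.
  by exists (fine (Lqpow 2 v)); rewrite fineK ?Lqpow2_fin_num.
have [dv dvE] : exists d, dirichlet v = d%:E.
  by exists (fine (dirichlet v)); rewrite fineK ?dirichlet_fin_num.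
have [Pv PvE] : exists P, Lqpow p v = P%:E.
  exists (fine (Lqpow p v)); rewrite fineK// ge0_fin_numE ?poweR_ge0//.
  exact: test_H01_Lqpow_lty.
have muf : measurable_fun Om (u \- f) by exact: measurable_funB.
have mvlo : m <= 2 * mv + 2 * eta.
  rewrite -lee_fin EFinD !EFinM -mE -mvE /Lqpow !Lq_sqr.
  apply: le_trans (integral_sqr_le mu mf muf _) _.
    by move=> x; have := sqr_ge0 (2 * f x - u x) ; rewrite /=; nra.
  by rewrite leeD2l// lee_pmul2l// ltW.
have mvhi : mv <= 2 * m + 2 * eta.
  rewrite -lee_fin EFinD !EFinM -mE -mvE /Lqpow !Lq_sqr.
  apply: le_trans (integral_sqr_le mf mu muf _) _.
    by move=> x; exact: sqr_le_split.
  by rewrite leeD2l// lee_pmul2l// ltW.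
have dvhi : dv <= 2 * d + 2 * eta.
  rewrite -lee_fin EFinD !EFinM -dE -dvE /dirichlet !Lq_sqr.
  have mG : measurable_fun Om (enorm \o h01_grad u).
    by apply: measurable_enorm => i; exact: H01_grad_measurable.
  have mGf : measurable_fun Om (enorm \o gradient f).
    apply: measurable_enorm => i.
    rewrite (_ : (fun x => _) = partial i f); last by apply/funext => x; rewrite mxE.
    exact: test_function_partial_measurable.
  have mGG : measurable_fun Om (enorm \o (fun x => h01_grad u x - gradient f x)).
    apply: measurable_enorm => i.
    rewrite (_ : (fun x => _) = fun x => h01_grad u x ord0 i - partial i f x).
      apply: measurable_funB; first exact: H01_grad_measurable.
      exact: test_function_partial_measurable.
    by apply/funext => x; rewrite !mxE.
  apply: le_trans (integral_sqr_le mGf mG mGG _) _.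
    by move=> x; exact: enorm_sqr_le_split.
  by rewrite leeD2l// lee_pmul2l// ltW.
have PvB : B <= Pv.
  have := lt_le_trans AT (truncation_le u p1 T0 mf).
  rewrite -/c VE -[(Lq Om p f `^ p)%E]/(Lqpow p v) PvE => ATP.
  have : ((B + V + 1)%:E < (Pv + (V + 1))%:E)%E.
    apply: lt_le_trans ATP _; rewrite !EFinD leeD2l// leeD2l//.
    apply: (@le_trans _ _ ((c ^+ 2)%:E * eta%:E)%E); last by rewrite -EFinM lee_fin.
    by apply: lee_wpmul2l; [rewrite lee_fin|exact: ltW].
  by rewrite lte_fin; lra.
have mv0 : 0 < mv by lra.
pose s := Num.sqrt (m / mv).
have s2 : s ^+ 2 = m / mv by rewrite sqr_sqrtr// divr_ge0// ltW.
have s0 : 0 <= s by exact: sqrtr_ge0.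
have s2hi : s ^+ 2 <= 4 by rewrite s2 ler_pdivrMr//; lra.
have slo : 2^-1 <= s.
  rewrite -(@ler_pXn2r _ 2)// ?nnegrE ?invr_ge0// s2 ler_pdivlMr// exprVn.
  by rewrite ler_pdivrMl// expr2; lra.
exists (scale_H01 mOm s v); split.
- rewrite Lqpow_scale// mvE mE -EFinM; congr EFin.
  by rewrite ger0_norm// powR_mulrn// s2 divfK// gt_eqF.
- by rewrite Lqpow_scale ?gt_eqF// PvE -EFinM ltry.
- rewrite /energy dirichlet_scale Lqpow_scale ?gt_eqF// dvE PvE.
  rewrite -!EFinM -EFinB lee_fin ger0_norm//.
  have sp : 2^-1 `^ p <= s `^ p.
    by rewrite ge0_ler_powR ?nnegrE ?invr_ge0// ltW.
  have key : `|K| + (4 * d + 4) <= p^-1 * (s `^ p * Pv).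
    rewrite ler_pdivlMl//.
    have -> : p * (`|K| + (4 * d + 4)) = 2^-1 `^ p * B.
      by rewrite /B [RHS]mulrC divfK// gt_eqF.
    by apply: ler_pM => //; exact: ltW.
  have dv4 : s ^+ 2 * dv <= 4 * (2 * d + 2).
    apply: ler_pM => //; first exact: sqr_ge0.
      by rewrite -lee_fin -dvE poweR_ge0.
    lra.
  have := ler_norm (- K); rewrite normrN.
  have := ler_norm K.
  lra.
Qed.

End approximation.

(** * The action along a ray *)

Section fiber.
Context {R : realType}.
Implicit Types p x y : R.

(** On the ray through an element [v] of the Nehari manifold, the action of
    [t *: v] is [fiber p (t ^+ 2)] times the [p]-th power of the [L^p]-norm of
    [v]. The variable is [t ^+ 2] because the mass is proportional to it. *)
Definition fiber p x : R := x / 2 - x `^ (p / 2) / p.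

(* The tangent line at [y] of the convex power bounds [fiber] from above; its
   slope has the sign of [1 - y], whence the three lemmas below. *)
Let fiber_diff p x y : 2 < p -> 0 <= x -> 0 <= y ->
  fiber p x <= fiber p y + (1 - y `^ (p / 2 - 1)) * (x - y) / 2.
Proof.
move=> p2 x0 y0.
have p0 : 0 < p by lra.
have r1 : 1 < p / 2 by lra.
have tangent := powR_tangent r1 y0 x0.
have : (y `^ (p / 2) + p / 2 * y `^ (p / 2 - 1) * (x - y)) / p <= x `^ (p / 2) / p.
  by rewrite ler_pM2r ?invr_gt0.
have -> : (y `^ (p / 2) + p / 2 * y `^ (p / 2 - 1) * (x - y)) / p =
    y `^ (p / 2) / p + y `^ (p / 2 - 1) * (x - y) / 2.
  by field; rewrite gt_eqF.
by rewrite /fiber => ?; nra.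
Qed.

Lemma fiber_nonincreasing p x y : 2 < p -> 1 <= y -> y <= x ->
  fiber p x <= fiber p y.
Proof.
move=> p2 y1 yx.
have y0 : 0 <= y by lra.
have x0 : 0 <= x by lra.
have := fiber_diff p2 x0 y0.
have E1 : (1 : R) = 1 `^ (p / 2 - 1) by rewrite powR1.
have : 1 <= y `^ (p / 2 - 1).
  by rewrite [leLHS]E1 ge0_ler_powR// ?nnegrE//; lra.
nra.
Qed.

Lemma fiber_nondecreasing p x y : 2 < p -> 0 <= x -> x <= y -> y <= 1 ->
  fiber p x <= fiber p y.
Proof.
move=> p2 x0 xy y1.
have y0 : 0 <= y by lra.
have := fiber_diff p2 x0 y0.
have E1 : (1 : R) = 1 `^ (p / 2 - 1) by rewrite powR1.
have : y `^ (p / 2 - 1) <= 1.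
  by rewrite [leRHS]E1 ge0_ler_powR// ?nnegrE//; lra.
nra.
Qed.

(** Strictness comes from two tangent lines: at the midpoint [y] of [1] and [x],
    where [fiber] strictly increases towards [1], and at [1], where it is flat. *)
Lemma fiber_lt1 p x : 2 < p -> 0 <= x -> x != 1 -> fiber p x < fiber p 1.
Proof.
move=> p2 x0 x1.
have e0 : 0 < p / 2 - 1 by lra.
pose y := (1 + x) / 2.
have y0 : 0 <= y by rewrite /y; lra.
have yx := fiber_diff p2 x0 y0.
have : fiber p y <= fiber p 1.
  have := fiber_diff p2 y0 ler01; rewrite powR1; lra.
suff : (1 - y `^ (p / 2 - 1)) * (x - y) < 0 by move=> ? ?; lra.
have E1 : (1 : R) = 1 `^ (p / 2 - 1) by rewrite powR1.
case: (ltgtP x 1) x1 => // x1 _.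
- have : y `^ (p / 2 - 1) < 1.
    by rewrite [ltRHS]E1 gt0_ltr_powR// ?nnegrE//; rewrite /y; lra.
  have : x - y < 0 by rewrite /y; lra.
  by move=> ? ?; rewrite pmulr_rlt0 ?subr_gt0.
- have : 1 < y `^ (p / 2 - 1).
    by rewrite [ltLHS]E1 gt0_ltr_powR// ?nnegrE//; rewrite /y; lra.
  have : 0 < x - y by rewrite /y; lra.
  by move=> ? ?; rewrite nmulr_rlt0 ?subr_lt0.
Qed.

Lemma fiber_le1 p x : 2 < p -> 0 <= x -> fiber p x <= fiber p 1.
Proof.
move=> p2 x0; have [->//|x1] := eqVneq x 1.
exact/ltW/fiber_lt1.
Qed.

Lemma fiber1_gt0 p : 2 < p -> 0 < fiber p 1.
Proof.
move=> p2; have p0 : 0 < p by lra.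
by rewrite /fiber powR1 subr_gt0 !mul1r ltf_pV2// posrE.
Qed.

End fiber.

(** * Biconjugates of convex functions *)

Section biconjugate.
Context {R : realType}.
Implicit Types (F : R -> \bar R).

(** A convex function has a supporting line at an interior point of its domain:
    the slopes of the chords ending at [x0] from the left are bounded by those
    of the chords starting there, and their supremum [m] is a subgradient. The
    supremum defining the biconjugate is then at least its term at [m]. *)
Lemma convex_le_biconjugate F (x0 y1 y2 : R) : convex_ereal F ->
  (forall x, 0 <= F x)%E -> y1 < x0 -> x0 < y2 ->
  (F y1 < +oo)%E -> (F x0 < +oo)%E -> (F y2 < +oo)%E ->
  (F x0 <= legendre (legendre F) x0)%E.
Proof.
move=> cF F0 y1x0 x0y2 Fy1 Fx0 Fy2.
pose f x := fine (F x).
have fE x : (F x < +oo)%E -> F x = (f x)%:E.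
  by move=> Fx; rewrite fineK// ge0_fin_numE.
have slopes y z : (F y < +oo)%E -> (F z < +oo)%E -> y < x0 -> x0 < z ->
    (f x0 - f y) / (x0 - y) <= (f z - f x0) / (z - x0).
  move=> Fy Fz yx xz.
  have yz : y < z by exact: lt_trans xz.
  pose t := (z - x0) / (z - y).
  have t1 : 1 - t = (x0 - y) / (z - y) by rewrite /t; field; rewrite subr_eq0 gt_eqF.
  have t01 : 0 <= t <= 1.
    rewrite -[t <= 1]subr_ge0 t1 /t !divr_ge0 ?subr_ge0//; exact: ltW.
  have := cF y z t t01.
  rewrite t1 (_ : t * y + _ = x0); last by rewrite /t; field; rewrite subr_eq0 gt_eqF.
  rewrite fE// (fE _ Fy) (fE _ Fz) -!EFinM -EFinD lee_fin /t => H.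
  rewrite ler_pdivlMr ?subr_gt0// mulrAC ler_pdivrMr ?subr_gt0//.
  have zy0 : 0 < z - y by rewrite subr_gt0.
  have : f x0 * (z - y) <= (z - x0) * f y + (x0 - y) * f z.
    rewrite -ler_pdivlMr//; move: H; congr (_ <= _).
    by field; rewrite gt_eqF.
  lra.
pose S := [set (f x0 - f y) / (x0 - y) | y in [set y | y < x0 /\ (F y < +oo)%E]].
have S0 : S !=set0 by exists ((f x0 - f y1) / (x0 - y1)); exists y1.
have Sub z : x0 < z -> (F z < +oo)%E -> ubound S ((f z - f x0) / (z - x0)).
  by move=> xz Fz _ [y /= [yx Fy] <-]; exact: slopes.
have hS : has_sup S by split => //; exists ((f y2 - f x0) / (y2 - x0)); exact: Sub.
pose m := sup S.
have support z : ((f x0 + m * (z - x0))%:E <= F z)%E.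
  have [Fz|] := boolP (F z < +oo)%E; last by rewrite -leNgt leye_eq => /eqP ->; rewrite leey.
  rewrite (fE _ Fz) lee_fin.
  case: (ltgtP z x0) => [zx|xz|->]; last by rewrite subrr mulr0 addr0.
    have : (f x0 - f z) / (x0 - z) <= m by apply: ub_le_sup; [case: hS|exists z].
    by rewrite ler_pdivrMr ?subr_gt0//; nra.
  have : m <= (f z - f x0) / (z - x0) by apply: ge_sup => //; exact: Sub.
  by rewrite ler_pdivlMr ?subr_gt0//; lra.
apply: (@le_trans _ _ ((m * x0)%:E - legendre F m)%E); last first.
  by apply: ereal_sup_ubound; exists m.
have : (legendre F m <= (m * x0 - f x0)%:E)%E.
  apply: ge_ereal_sup => _ [z _ <-].
  apply: (@le_trans _ _ ((z * m)%:E - (f x0 + m * (z - x0))%:E)%E).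
    by apply: leeB.
  by rewrite -EFinB lee_fin; lra.
move=> leg; rewrite fE//.
apply: (@le_trans _ _ ((m * x0)%:E - (m * x0 - f x0)%:E)%E).
  by rewrite -EFinB lee_fin; lra.
exact: leeB.
Qed.

End biconjugate.

(** * Levels and rays *)

Section levels_scaling.
Context {R : realType} {N : nat} (Om : set 'rV[R]_N) (p : R).
Hypothesis mOm : measurable Om.
Hypothesis Omoo : (lebesgue_rV N Om < +oo)%E.
Hypothesis p2 : 2 < p.
Local Notation leb := (lebesgue_rV N).
Local Notation J := (action_level Om p).
Implicit Types (u v w : H01 Om) (lam mu t d m P : R).

Let p0 : 0 < p. Proof. by rewrite (lt_trans _ p2). Qed.
Let pn0 : p != 0. Proof. by rewrite gt_eqF. Qed.

Lemma nonzeroP u q : 0 < q -> nonzero u <-> (0 < Lqpow q u)%E.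
Proof.
move=> q0; have qn0 : q != 0 by rewrite gt_eqF.
have mu : measurable_fun setT (u \_ Om).
  by apply/(measurable_restrictT _ mOm); exact: H01_measurable.
split=> [unz|uq uz].
  rewrite lt0e poweR_ge0 andbT; apply/eqP => uq; apply: unz.
  have u0 : Lq Om q u = 0%E.
    by apply: poweR_eq0_eq0 uq; exact: Lq_ge0.
  have : (EFin \o (u \_ Om)) = \0%E %[ae leb].
    by apply: Lnorm_eq0_eq0 u0; [exact/measurable_EFinP|rewrite lte_fin].
  apply: filterS => x /= /(_ Logic.I) /eqP + Omx.
  by rewrite patchE mem_set// eqe => /eqP.
move: uq; rewrite /Lqpow Lq_pow// (_ : (\int[leb]_(x in Om) _)%E = 0%E) ?ltxx//.
rewrite (@ae_eq_integral _ _ _ leb Om (cst 0%E)) ?integral0//.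
  apply/measurable_EFinP; apply: measurable_powRn => //; exact: H01_measurable.
by apply: filterS uz => x ux Omx; rewrite /= ux// normr0 powR0.
Qed.

(** Finiteness of [P] is a genuine condition, which holds on the Nehari
    manifolds by their equation. *)
Definition has_norms u d m P : Prop :=
  [/\ dirichlet u = d%:E, Lqpow 2 u = m%:E & Lqpow p u = P%:E].

Lemma has_norms_exists u : (Lqpow p u < +oo)%E -> exists d m P, has_norms u d m P.
Proof.
move=> Pu; exists (fine (dirichlet u)), (fine (Lqpow 2 u)), (fine (Lqpow p u)).
by split; rewrite fineK ?dirichlet_fin_num ?Lqpow2_fin_num ?ge0_fin_numE ?poweR_ge0.
Qed.

Lemma has_norms_ge0 u d m P : has_norms u d m P -> [/\ 0 <= d, 0 <= m & 0 <= P].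
Proof. by move=> [dE mE PE]; rewrite -!lee_fin -dE -mE -PE !poweR_ge0. Qed.

Lemma has_norms_scale t u d m P : 0 <= t -> has_norms u d m P ->
  has_norms (scale_H01 mOm t u) (t ^+ 2 * d) (t ^+ 2 * m) (t `^ p * P).
Proof.
move=> t0 [dE mE PE]; split.
- by rewrite dirichlet_scale dE.
- by rewrite Lqpow_scale// mE ger0_norm// powR_mulrn.
- by rewrite Lqpow_scale// PE ger0_norm.
Qed.

Lemma action_has_norms lam u d m P : has_norms u d m P ->
  action p lam u = (d / 2 + lam / 2 * m - P / p)%:E.
Proof.
move=> [dE mE PE]; rewrite /action dE mE PE -!(EFinM, EFinD, EFinN).
by congr EFin; ring.
Qed.

Lemma energy_has_norms u d m P : has_norms u d m P ->
  energy p u = (d / 2 - P / p)%:E.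
Proof.
move=> [dE mE PE]; rewrite /energy dE PE -!(EFinM, EFinD, EFinN).
by congr EFin; ring.
Qed.

Lemma nehari_has_norms lam u : nehari p lam u -> exists d m P,
  [/\ has_norms u d m P, 0 <= d, 0 < m, 0 < P & d + lam * m = P].
Proof.
move=> [unz uN].
have [|d [m [P nu]]] := @has_norms_exists u.
  rewrite -uN -(fineK (dirichlet_fin_num mOm u)) -(fineK (Lqpow2_fin_num mOm u)).
  by rewrite -EFinM -EFinD ltry.
exists d, m, P; have [d0 _ _] := has_norms_ge0 nu; have [dE mE PE] := nu.
move/(nonzeroP _ (ltr0Sn R 1)) : (unz); rewrite mE lte_fin => m0.
move/(nonzeroP _ p0) : (unz); rewrite PE lte_fin => P0.
by split => //; move: uN; rewrite dE mE PE -EFinM -EFinD => -[].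
Qed.

Lemma has_norms_nehari lam u d m P : has_norms u d m P -> 0 < m ->
  d + lam * m = P -> nehari p lam u.
Proof.
move=> [dE mE PE] m0 dmP; split; last by rewrite dE mE PE -EFinM -EFinD dmP.
by apply/(nonzeroP _ (ltr0Sn R 1)); rewrite mE lte_fin.
Qed.

Lemma action_nehari lam u d m P : has_norms u d m P -> d + lam * m = P ->
  action p lam u = (P * fiber p 1)%:E.
Proof.
move=> nu dmP; rewrite (action_has_norms lam nu); congr EFin.
by rewrite /fiber powR1 -dmP; field.
Qed.

Lemma action_level_le lam u d m P : has_norms u d m P -> 0 < m ->
  d + lam * m = P -> (J lam <= (P * fiber p 1)%:E)%E.
Proof.
move=> nu m0 dmP; rewrite -(action_nehari nu dmP).
by apply: ereal_inf_lbound; exists u => //; exact: has_norms_nehari dmP.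
Qed.

Lemma action_level_ge0 lam : (0 <= J lam)%E.
Proof.
apply: le_ereal_inf_tmp => _ [u /nehari_has_norms[d [m [P [nu _ _ P0 dmP]]]] <-].
by rewrite (action_nehari nu dmP) lee_fin mulr_ge0 ?ltW ?fiber1_gt0.
Qed.

Lemma powR_split2 t : 0 < t -> t `^ p = t ^+ 2 * t `^ (p - 2).
Proof.
move=> t0; rewrite -powR_mulrn ?ltW// -powRD ?subrKC//.
by rewrite gt_eqF// implybT.
Qed.

(** The multiplier [t] solves the Nehari equation on the ray through [u]. *)
Lemma action_level_lty lam u d m P : has_norms u d m P -> 0 < m -> 0 < P ->
  0 < d + lam * m -> (J lam < +oo)%E.
Proof.
move=> nu m0 P0 dm0.
pose t := ((d + lam * m) / P) `^ (p - 2)^-1.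
have t0 : 0 < t by apply: powR_gt0; exact: divr_gt0.
have tp : t `^ (p - 2) = (d + lam * m) / P.
  by rewrite -powRrM mulVf ?powRr1 ?divr_ge0 ?ltW// gt_eqF// subr_gt0.
have nv := has_norms_scale (ltW t0) nu.
apply: le_lt_trans (action_level_le (lam := lam) nv _ _) _.
- by rewrite mulr_gt0 ?exprn_gt0.
- by rewrite powR_split2// tp; field; rewrite gt_eqF.
- exact: ltry.
Qed.

(** The element of mass [mu] on the ray through [u] is a competitor for the
    energy level, and energy plus [lam] times mass is the action. *)
Lemma dual_le_fiber lam mu u d m P : has_norms u d m P -> 0 < m ->
  d + lam * m = P -> 0 <= mu ->
  ((lam * mu)%:E + energy_level Om p mu <= (P * fiber p (2 * mu / m))%:E)%E.
Proof.
move=> nu m0 dmP mu0.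
pose t := Num.sqrt (2 * mu / m).
have x0 : 0 <= 2 * mu / m by rewrite divr_ge0 ?mulr_ge0// ltW.
have t0 : 0 <= t by exact: sqrtr_ge0.
have t2 : t ^+ 2 = 2 * mu / m by rewrite sqr_sqrtr.
have tp : t `^ p = (2 * mu / m) `^ (p / 2).
  by rewrite -t2 -powR_mulrn// -powRrM; congr (_ `^ _); field.
have nw := has_norms_scale t0 nu.
apply: (@le_trans _ _ ((lam * mu)%:E + energy p (scale_H01 mOm t u))%E).
  rewrite leeD2l//; apply: ereal_inf_lbound; exists (scale_H01 mOm t u) => //.
  rewrite /mass_constrained /= /mass; have [_ -> _] := nw.
  by rewrite -EFinM t2; congr EFin; field; rewrite gt_eqF.
rewrite (energy_has_norms nw) -EFinD lee_fin t2 tp /fiber -dmP.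
by rewrite le_eqVlt; apply/orP; left; apply/eqP; field; rewrite pn0 gt_eqF.
Qed.

(** The action of [u] is the maximum of the action on the ray through [u]. *)
Lemma dual_le_action_level lam mu : 0 <= mu ->
  ((lam * mu)%:E + energy_level Om p mu <= J lam)%E.
Proof.
move=> mu0; apply: le_ereal_inf_tmp.
move=> _ [u /nehari_has_norms[d [m [P [nu _ m0 P0 dmP]]]] <-].
apply: le_trans (dual_le_fiber nu m0 dmP mu0) _.
rewrite (action_nehari nu dmP) lee_fin ler_pM2l//.
by apply: fiber_le1 => //; apply: divr_ge0; [exact: mulr_ge0|exact: ltW].
Qed.

Lemma mass_Lqpow2 u mu : mass u = mu%:E -> Lqpow 2 u = (2 * mu)%:E.
Proof.
rewrite /mass -(fineK (Lqpow2_fin_num mOm u)) -EFinM => -[<-].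
by congr EFin; field.
Qed.

(** Every [u] of positive mass and finite [L^p]-norm lies on the
    Nehari manifold of its own multiplier [lam], so its action bounds the action
    level at that [lam]. *)
Lemma conjugate_energy_le u mu : mass u = mu%:E -> 0 < mu ->
  (Lqpow p u < +oo)%E -> (- legendre J mu <= energy p u)%E.
Proof.
move=> uM mu0 /has_norms_exists[d [m [P nu]]].
have mE : m = 2 * mu by have [_ + _] := nu; rewrite (mass_Lqpow2 uM) => -[].
have m0 : 0 < m by rewrite mE mulr_gt0.
pose lam := (P - d) / m.
have dmP : d + lam * m = P by rewrite /lam divfK ?gt_eqF// subrKC.
have := action_level_le nu m0 dmP; rewrite -(action_nehari nu dmP).
rewrite (action_has_norms lam nu) (energy_has_norms nu) => JE.
rewrite leeNl; apply: (@le_trans _ _ ((lam * mu)%:E - J lam)%E); last first.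
  by apply: ereal_sup_ubound; exists lam.
apply: le_trans (leeB (lexx _) JE).
by rewrite -EFinB -EFinN lee_fin mE; lra.
Qed.

Lemma conjugate_le_energy_level mu : 0 < mu ->
  (- legendre J mu <= energy_level Om p mu)%E.
Proof.
move=> mu0; apply: le_ereal_inf_tmp => _ [u uM <-].
have [Pu|] := boolP (Lqpow p u < +oo)%E; first exact: conjugate_energy_le.
rewrite -leNgt leye_eq => /eqP Pu.
suff -> : (- legendre J mu = -oo)%E by rewrite leNye.
apply: eq_ninfty => K.
have [||//|w [wM Pw wK]] := @low_energy_of_infinite_Lqpow _ _ _ mOm Omoo p u K.
- by rewrite (lt_trans _ p2)// ltr1n.
- by rewrite (mass_Lqpow2 uM) lte_fin mulr_gt0.
apply: le_trans wK; apply: conjugate_energy_le => //.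
by rewrite /mass wM.
Qed.

(** Multiples [t *: u] with small [t] lie on the Nehari manifolds of multipliers
    [l <= lam] and have small action. For [mu <= 0] these [l] witness that the
    supremum defining the conjugate is at least [lam * mu] up to [e]. *)
Lemma conjugate_nonpos lam mu u : nehari p lam u -> mu <= 0 ->
  ((lam * mu)%:E <= legendre J mu)%E.
Proof.
move=> /nehari_has_norms[d [m [P [nu d0 m0 P0 dmP]]]] mu0.
apply/lee_subgt0Pr => e e0.
pose t := Num.min 1 (e / (P * fiber p 1)).
have f0 : 0 < fiber p 1 by exact: fiber1_gt0.
have Pf0 : 0 < P * fiber p 1 by rewrite mulr_gt0.
have t0 : 0 < t by rewrite lt_min ltr01 divr_gt0.
have t1 : t <= 1 by rewrite ge_min lexx.
have te : t * (P * fiber p 1) <= e by rewrite -ler_pdivlMr// ge_min lexx orbT.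
have tp1 : t `^ (p - 2) <= 1.
  have E1 : (1 : R) = 1 `^ (p - 2) by rewrite powR1.
  by rewrite [leRHS]E1 ge0_ler_powR ?nnegrE ?(ltW t0)// subr_ge0 ltW.
have tp : t `^ p <= t.
  rewrite powR_split2//; apply: (@le_trans _ _ (t ^+ 2)).
    by rewrite ler_piMr ?sqr_ge0.
  by rewrite expr2 ler_piMr// ltW.
pose l := (t `^ (p - 2) * P - d) / m.
have nv := has_norms_scale (ltW t0) nu.
have tm0 : 0 < t ^+ 2 * m by rewrite mulr_gt0// exprn_gt0.
have Jl : (J l <= e%:E)%E.
  apply: le_trans (action_level_le (lam := l) nv tm0 _) _.
    by rewrite powR_split2// /l; field; rewrite gt_eqF.
  by rewrite lee_fin; apply: le_trans te; rewrite -mulrA ler_wpM2r// ltW.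
have llam : l <= lam by rewrite /l ler_pdivrMr// -dmP; nra.
apply: (@le_trans _ _ ((l * mu)%:E - J l)%E); last first.
  by apply: ereal_sup_ubound; exists l.
apply: (@le_trans _ _ ((l * mu)%:E - e%:E)%E); last exact: leeB.
by rewrite -!EFinB lee_fin lerB//; nra.
Qed.

Lemma energy_level0_ge0 : (0 <= energy_level Om p 0)%E.
Proof.
apply: le_ereal_inf_tmp => _ [u uM <-].
have u0 : Lqpow 2 u = 0%E by rewrite (mass_Lqpow2 uM) mulr0.
have up : Lqpow p u = 0%E.
  have := poweR_ge0 (Lq Om p u) p; rewrite -/(Lqpow p u) le_eqVlt => /orP[/eqP <-//|].
  by move/(nonzeroP _ p0)/(nonzeroP _ (ltr0Sn R 1)); rewrite u0 ltxx.
by rewrite /energy up mule0 sube0 mule_ge0// ?poweR_ge0// lee_fin.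
Qed.

End levels_scaling.

(** * Duality and the strict gap *)

Local Open Scope ereal_scope.

(** By [dual_le_fiber], the dual level is bounded by two functions of [mu], one
    for each ground state, with the same strict maximum but attained at
    different points. Beyond the midpoint the first stays away from the maximum,
    before it the second does; the supremum is therefore strictly smaller,
    whether or not it is attained. *)
Lemma dual_level_lt (R : realType) (N : nat) (Om : set 'rV[R]_N) (p lam : R)
    (v1 v2 : H01 Om) (d1 m1 d2 m2 P : R) :
  measurable Om -> (2 < p)%R ->
  has_norms p v1 d1 m1 P -> (0 < m1)%R -> (d1 + lam * m1 = P)%R ->
  has_norms p v2 d2 m2 P -> (0 < m2)%R -> (d2 + lam * m2 = P)%R ->
  (0 < P)%R -> (m1 < m2)%R ->
  ereal_sup [set (lam * mu)%:E + energy_level Om p mu | mu in [set mu | (0 <= mu)%R]]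
    < (P * fiber p 1)%:E.
Proof.
move=> mOm p2 n1 m10 e1 n2 m20 e2 P0 m12.
pose mid : R := ((m1 + m2) / 2)%R.
have mid1 : (1 < mid / m1)%R by rewrite ltr_pdivlMr// /mid; lra.
have mid2 : (mid / m2 < 1)%R by rewrite ltr_pdivrMr// /mid; lra.
have mid20 : (0 <= mid / m2)%R by apply: divr_ge0; [rewrite /mid; lra|exact: ltW].
pose c := Num.max (fiber p (mid / m1)) (fiber p (mid / m2)).
have c1 : (c < fiber p 1)%R.
  rewrite gt_max; apply/andP; split; apply: fiber_lt1 => //.
  - by rewrite ltW// (lt_trans ltr01).
  - by rewrite gt_eqF.
  - by rewrite lt_eqF.
apply: (@le_lt_trans _ _ (P * c)%:E); last by rewrite lte_fin ltr_pM2l.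
apply: ge_ereal_sup => _ [mu /= mu0 <-].
have [midmu|mumid] := lerP mid (2 * mu)%R.
  apply: le_trans (dual_le_fiber mOm p2 n1 m10 e1 mu0) _.
  rewrite lee_fin ler_pM2l// le_max; apply/orP; left.
  by apply: fiber_nonincreasing => //; [exact: ltW|rewrite ler_pM2r ?invr_gt0].
apply: le_trans (dual_le_fiber mOm p2 n2 m20 e2 mu0) _.
rewrite lee_fin ler_pM2l// le_max; apply/orP; right.
apply: fiber_nondecreasing => //.
- by apply: divr_ge0; [exact: mulr_ge0|exact: ltW].
- by rewrite ler_pM2r ?invr_gt0// ltW.
- exact: ltW.
Qed.

(** The conjugate of the action level is [- energy_level] at positive masses.
    Negative masses contribute nothing, since the conjugate dominates
    [lam * mu] there and mass zero already gives the value [0]. *)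
Lemma biconjugate_action_level (R : realType) (N : nat) (Om : set 'rV[R]_N)
    (p lam : R) (v : H01 Om) :
  measurable Om -> lebesgue_rV N Om < +oo -> (2 < p)%R -> nehari p lam v ->
  legendre (legendre (action_level Om p)) lam =
    ereal_sup [set (lam * mu)%:E + energy_level Om p mu
              | mu in [set mu | (0 <= mu)%R]].
Proof.
move=> mOm Omoo p2 vN; apply/eqP; rewrite eq_le; apply/andP; split.
  apply: ge_ereal_sup => _ [mu _ <-]; rewrite mulrC.
  have [mu0|mu0] := lerP mu 0%R.
    apply: (@le_trans _ _ 0).
      apply: le_trans (leeB (lexx _) (conjugate_nonpos mOm p2 vN mu0)) _.
      by rewrite -EFinB subrr.
    apply: (@le_trans _ _ ((lam * 0)%:E + energy_level Om p 0)).
      by rewrite mulr0 add0e; exact: energy_level0_ge0.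
    by apply: ereal_sup_ubound; exists 0%R => /=.
  apply: (@le_trans _ _ ((lam * mu)%:E + energy_level Om p mu)).
    by apply: leeD2l; exact: conjugate_le_energy_level.
  by apply: ereal_sup_ubound; exists mu => //=; exact: ltW.
apply: ge_ereal_sup => _ [mu /= mu0 <-].
apply: (@le_trans _ _ ((mu * lam)%:E - legendre (action_level Om p) mu)); last first.
  by apply: ereal_sup_ubound; exists mu.
rewrite mulrC; apply: leeD2l; rewrite leeNr; apply: ge_ereal_sup => _ [l _ <-].
have := dual_le_action_level mOm p2 l mu0.
have := action_level_ge0 mOm p2 l.
case: (action_level Om p l) => [j| |]//= _;
  case: (energy_level Om p mu) => [e| |]//=; rewrite ?leey ?leNye//.
by rewrite -!EFinD !lee_fin; lra.
Qed.

Theorem theorem1p4 (R : realType) (N : nat) (Om : set 'rV[R]_N) (p lam : R)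
  (hN : (0 < N)%N) (Om_open : open Om) (Om_nonempty : Om !=set0)
  (Om_finite : lebesgue_rV N Om < +oo)
  (hp : (2 < p <= 2 + 4 / N%:R)%R)
  (v1 v2 : H01 Om)
  (hv1 : action_ground_state p lam v1) (hv2 : action_ground_state p lam v2)
  (hmass : Lq Om 2 v1 <> Lq Om 2 v2) :
  let J := action_level Om p in
  [/\ J lam > legendre (legendre J) lam,
      legendre (legendre J) lam =
        ereal_sup [set (lam * mu)%:E + energy_level Om p mu
                  | mu in [set mu | (0 <= mu)%R]]
    & ~ convex_ereal J].
Proof.
move=> J; have mOm := open_measurable_rV Om_open.
have /andP[p2 _] := hp.
have [N1 A1] := hv1; have [N2 A2] := hv2.
have [d1 [m1 [P1 [n1 _ m10 P10 e1]]]] := nehari_has_norms mOm p2 N1.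
have [d2 [m2 [P2 [n2 _ m20 P20 e2]]]] := nehari_has_norms mOm p2 N2.
have J1 : J lam = (P1 * fiber p 1)%:E by rewrite /J -A1 (action_nehari p2 n1 e1).
have J2 : J lam = (P2 * fiber p 1)%:E by rewrite /J -A2 (action_nehari p2 n2 e2).
have P12 : P2 = P1.
  by move: J1; rewrite J2 => -[]; apply: mulIf; rewrite gt_eqF ?fiber1_gt0.
rewrite P12 in n2 e2.
have gap : legendre (legendre J) lam < J lam.
  rewrite (biconjugate_action_level mOm Om_finite p2 N1) J1.
  case: (ltgtP m1 m2) => m12.
  - exact: (dual_level_lt mOm p2 n1 m10 e1 n2 m20 e2).
  - exact: (dual_level_lt mOm p2 n2 m20 e2 n1 m10 e1).
  (* equal values of [m] mean equal [L^2]-norms *)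
  - exfalso; apply: hmass.
    have [[_ + _] [_ + _]] := (n1, n2); rewrite -m12 /Lqpow => <- /esym E12.
    have := congr1 (fun x => x `^ (2^-1)) E12.
    by rewrite -!poweRrM mulfV ?pnatr_eq0// !poweRe1 ?Lq_ge0.
split => //; first exact: biconjugate_action_level N1.
move=> cJ; move: gap; rewrite ltNge => /negP; apply.
have Joo x : (0 < d1 + x * m1)%R -> J x < +oo.
  by move=> ?; apply: (action_level_lty mOm p2 n1).
apply: (@convex_le_biconjugate _ J lam (lam - P1 / (2 * m1)) (lam + 1)) => //.
- by move=> x; exact: action_level_ge0.
- by rewrite ltrBlDr ltrDl divr_gt0// mulr_gt0.
- by rewrite ltrDl.
- apply: Joo; rewrite mulrBl addrA e1.
  rewrite (_ : _ / _ * _ = P1 / 2)%R; last by field; rewrite gt_eqF.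
  lra.
- by rewrite J1 ltry.
- by apply: Joo; rewrite mulrDl addrA e1 mul1r addr_gt0.
Qed.
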